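(* Let $m\ge R\ge 2$ be integers, let $S_j(x)=\frac1R x+\frac{j}{mR}(R-1)$ for $j=0,\dots,m$, and let $p_0,\dots,p_m>0$ be probabilities ($\sum_j p_j=1$) satisfying $p_0=p_m<\min_{j\ne0,m}p_j$. Let $\mu$ be the self-similar probability measure satisfying $\mu=\sum_{j=0}^m p_j\,\mu\circ S_j^{-1}$. Then the set of essential points of $\mu$ is the open interval $(0,1)$, and $\dim\mu(0)$ is an isolated point in the set of all local dimensions of $\mu$. Indeed, for $x\in(0,1)$ (for which the local dimension exists), $$\dim\mu(x)\le\frac{\left|\log\left(\min\{2p_0,\ p_j: j\ne0,m\}\right)\right|}{\log R}<\frac{|\log p_0|}{\log R}=\dim\mu(0).$$
   Context: The support of $\mu$ is $[0,1]$. Put $\varrho=1/R$, $\mathcal A=\{0,\dots,m\}$ and, for $\sigma=(j_1,\dots,j_n)\in\mathcal A^n$, $S_\sigma=S_{j_1}\circ\cdots\circ S_{j_n}$. Local dimension. $\dim\mu(x)=\lim_{r\to0^+}\frac{\log\mu([x-r,x+r])}{\log r}$ when the limit exists. Net intervals and characteristic vectors. For $n\ge1$ let $h_1<\dots<h_{s_n}$ be the distinct elements of $\{S_\sigma(0),S_\sigma(1):\sigma\in\mathcal A^n\}$; the net intervals of level $n$ are $\mathcal F_n=\{[h_j,h_{j+1}]:1\le j<s_n\}$, and $\mathcal F_0=\{[0,1]\}$. Each $\Delta\in\mathcal F_n$ ($n\ge1$) lies in a unique $\widehat\Delta\in\mathcal F_{n-1}$, its parent ($\Delta$ is a child of $\widehat\Delta$).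 For $\Delta=[a,b]\in\mathcal F_n$ put $\ell_n(\Delta)=\varrho^{-n}(b-a)$, and let $V_n(\Delta)=(a_1,\dots,a_k)$ be the increasing list of the distinct values $\varrho^{-n}(a-S_\sigma(0))$ over $\sigma\in\mathcal A^n$ with $\Delta\subseteq S_\sigma[0,1]$. Let $r_n(\Delta)$ be the position of $\Delta$, from left to right, among the children of $\widehat\Delta$ with the same $\ell_n$ and $V_n$. The characteristic vector is $\mathcal C_n(\Delta)=(\ell_n(\Delta),V_n(\Delta),r_n(\Delta))$, with $\mathcal C_0([0,1])=(1,(0),1)$. $\Omega$ is the set of all characteristic vectors; it is finite for this iterated function system. $\beta\in\Omega$ is a child of $\alpha\in\Omega$ (its parent) if $\alpha=\mathcal C_{n-1}(\widehat\Delta)$, $\beta=\mathcal C_n(\Delta)$ for some parent/child pair. An admissible path is a tuple $(\gamma_1,\dots,\gamma_n)$ in $\Omega$ with each $\gamma_j$ the parent of $\gamma_{j+1}$. A symbolic representation of $x\in[0,1]$ is $[x]=(\mathcal C_0(\Delta_0),\mathcal C_1(\Delta_1),\dots)$, where $x\in\Delta_n\in\mathcal F_n$ and $\Delta_n$ is the parent of $\Delta_{n+1}$ for all $n$ (unique unless $x$ is an endpoint of a net interval, in which case there may be two). Loop and essential classes. A non-empty $\Omega'\subseteq\Omega$ is a loop class if for all $\alpha,\beta\in\Omega'$ there is an admissible path $(\gamma_1,\dots,\gamma_n)$, $n\ge2$, with all $\gamma_j\in\Omega'$, $\gamma_1=\alpha$, $\gamma_n=\beta$. The essential class $\Omega_0$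 is the loop class with the further property that every child in $\Omega$ of an element of $\Omega_0$ is in $\Omega_0$; there is exactly one such class (a known result of Feng). A point $x$ is essential if it has a symbolic representation $(\gamma_0,\gamma_1,\dots)$ with $\gamma_j\in\Omega_0$ for all large $j$. *)

(* Defs.v *)
From HB Require Import structures.
From mathcomp Require Import all_boot all_order all_algebra.
From mathcomp Require Import all_classical all_reals all_analysis.
Import numFieldNormedType.Exports.

Set Implicit Arguments.
Unset Strict Implicit.
Unset Printing Implicit Defensive.

Import Order.TTheory GRing.Theory Num.Theory.

Local Open Scope classical_set_scope.
Local Open Scope ring_scope.

Definition ifs (K : realType) (m R : nat) (j : 'I_m.+1) (x : K) : K :=
  R%:R^-1 * x + j%:R / (m%:R * R%:R) * (R%:R - 1).

Section LocalDimension.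
Variables (K : realType) (mu : probability (measurableTypeR K) K).

Definition self_similar (m : nat) (S : 'I_m.+1 -> K -> K) (p : 'I_m.+1 -> K) :=
  forall A : set (measurableTypeR K), measurable A ->
    mu A = (\sum_(j < m.+1) (p j)%:E * mu (S j @^-1` A))%E.

Definition supp : set K :=
  [set x | forall U : set K, open U -> U x -> (0 < mu U)%E].

(* [lne 0 = -oo], whereas [ln 0 = 0]; so the quotient is [+oo] on null balls
   of radius less than 1. *)
Definition dim_quotient (x r : K) : \bar K :=
  (lne (mu `[(x - r)%R, (x + r)%R]%classic) / (ln r)%:E)%E.

Definition has_local_dim (x : K) := cvg (dim_quotient x r @[r --> 0^'+]).

(* Meaningful when [has_local_dim x]. *)
Definition local_dim (x : K) : \bar K := lim (dim_quotient x r @[r --> 0^'+]).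

Definition local_dims : set (\bar K) :=
  [set local_dim x | x in [set x | supp x /\ has_local_dim x]].

End LocalDimension.

Section NetIntervals.
Variables (K : realType) (m : nat) (S : 'I_m.+1 -> K -> K) (rho : K).

Definition word_map (s : seq 'I_m.+1) (x : K) : K := foldr S x s.

Definition words (n : nat) : seq (n.-tuple 'I_m.+1) := enum {: n.-tuple 'I_m.+1}.

Definition net_points (n : nat) : seq K :=
  sort <=%R (undup ([seq word_map s 0 | s : n.-tuple 'I_m.+1 <- words n] ++
                    [seq word_map s 1 | s : n.-tuple 'I_m.+1 <- words n])).

(* A net interval [a, b] is encoded by the pair (a, b). *)
Definition cell (D : K * K) : set K := `[D.1, D.2]%classic.

Definition net_intervals (n : nat) : seq (K * K) :=
  if n is 0 then [:: (0, 1)]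
  else let h := net_points n in zip h (behead h).

(* The level-n net interval containing [D]; it is unique when [D] is a net
   interval of level n+1. The default value [D] is then never used. *)
Definition parent (n : nat) (D : K * K) : K * K :=
  head D [seq E <- net_intervals n | `[< cell D `<=` cell E >]].

Definition children (n : nat) (D : K * K) : seq (K * K) :=
  [seq E <- net_intervals n.+1 | parent n E == D].

Definition norm_length (n : nat) (D : K * K) : K := rho ^- n * (D.2 - D.1).

Definition neighbours (n : nat) (D : K * K) : seq K :=
  sort <=%R (undup
    [seq rho ^- n * (D.1 - word_map s 0) |
      s : n.-tuple 'I_m.+1 <- words n & `[< cell D `<=` word_map s @` `[0, 1]%classic >]]).

Definition position (n : nat) (D : K * K) : nat :=
  if n is n'.+1 then
    (index D [seq E <- children n' (parent n' D) |
                (norm_length n E == norm_length n D) &&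
                (neighbours n E == neighbours n D)]).+1
  else 1%N.

Definition charvec : Type := (K * seq K * nat)%type.

Definition char_vector (n : nat) (D : K * K) : charvec :=
  if n is 0 then (1, [:: 0], 1%N)
  else (norm_length n D, neighbours n D, position n D).

Definition Omega : set charvec :=
  [set a | exists n D, D \in net_intervals n /\ a = char_vector n D].

Definition is_child (b a : charvec) : Prop :=
  exists n D, [/\ D \in net_intervals n.+1,
                  a = char_vector n (parent n D) &
                  b = char_vector n.+1 D].

(* The path is (g 0, ..., g (n-1)). *)
Definition admissible_path (n : nat) (g : nat -> charvec) : Prop :=
  (forall j, (j < n)%N -> Omega (g j)) /\
  (forall j, (j.+1 < n)%N -> is_child (g j.+1) (g j)).

Definition loop_class (W : set charvec) : Prop :=
  [/\ W `<=` Omega, W !=set0 &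
      forall a b, W a -> W b -> exists n g,
        [/\ (2 <= n)%N, admissible_path n g,
            forall j, (j < n)%N -> W (g j), g 0%N = a & g n.-1 = b]].

Definition essential_class (W : set charvec) : Prop :=
  loop_class W /\ (forall a b, W a -> is_child b a -> W b).

Definition symbolic_representation (x : K) (g : nat -> charvec) : Prop :=
  exists D : nat -> K * K,
    forall n, [/\ D n \in net_intervals n, cell (D n) x,
                  D n = parent n (D n.+1) & g n = char_vector n (D n)].

(* There is exactly one essential class, so [exists W] reads "the class". *)
Definition essential_points : set K :=
  [set x | exists W, essential_class W /\
     exists g, symbolic_representation x g /\
               exists N : nat, forall j, (N <= j)%N -> W (g j)].

End NetIntervals.

(* Main.v *)
Require Import Defs.
From mathcomp Require Import all_boot all_order all_algebra.
From mathcomp Require Import all_classical all_reals all_analysis.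
From mathcomp Require Import zify ring lra.
Import Order.TTheory GRing.Theory Num.Theory.
Import numFieldNormedType.Exports.
Local Open Scope classical_set_scope.
Local Open Scope ring_scope.

(* The level-n images of [0,1] are the translates of [0, R^-n] by the multiples
   k (R-1)/(m R^n), with no gap in the range of k. Hence away from the ends of
   [0,1] the net does not notice that k is bounded: call a net interval interior
   if it lies in [e, 1-e], where e = R^-n - (R-1)/(m R^n). This can be read off
   its length and neighbour set, it is inherited by children, and the maps S_s
   carry interior net intervals to interior net intervals with the same
   children. The essential class therefore consists of the characteristic
   vectors of the net intervals with interior parent, and every point of (0,1),
   but neither 0 nor 1, eventually lies in interior net intervals only.

   For the dimensions, let w_n(k) be the total weight of the words of length n
   with index k. Then w_{n+1}(l) is the sum of p_j w_n(k) over l = k R + j.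
   Unless l is extremal, either an interior digit j occurs in this sum or (when
   m = R and R divides l) both extremal digits do, so w_{n+1}(l) is at least q
   times the least w_n at the parents of l. For x in (0,1), all indices of level-n
   intervals containing x are non-extremal for large n, so balls of radius 2 R^-n
   around x have mass at least c q^n. At 0 and 1 only one map contributes, and
   dividing the radius of a small ball by R multiplies its mass by p_0. *)

(** * Finite ordered lists and their consecutive elements *)

Section Greatest.
Set Implicit Arguments.
Unset Strict Implicit.
Unset Printing Implicit Defensive.

(** Stated for an arbitrary total order, so that the dual order yields least elements too. *)
Lemma mem_greatest d (T : orderType d) (s : seq T) (a0 : T) : a0 \in s ->
  exists2 a, a \in s & forall c, c \in s -> (c <= a)%O.
Proof.
elim: s a0 => // v s IH a0 _; case: s IH => [|w s] IH.
  by exists v; rewrite ?mem_head // => c; rewrite inE => /eqP->.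
have [b bs bP] := IH w (mem_head _ _).
have [bv|vb] := leP b v.
  exists v; rewrite ?mem_head // => c; rewrite inE => /predU1P[->//|/bP cb].
  exact: le_trans bv.
exists b; first by rewrite inE bs orbT.
by move=> c; rewrite inE => /predU1P[->|/bP//]; apply: ltW.
Qed.

End Greatest.

Section ConsecutivePairs.
Set Implicit Arguments.
Unset Strict Implicit.
Unset Printing Implicit Defensive.
Variable K : realDomainType.
Implicit Types (h : seq K) (a b c x : K).

(** Adjacency in a sorted list becomes a condition on the order alone, so that membership in
    [net_intervals] can be argued without lists. *)
Lemma mem_zip_behead h a b : sorted <%R h ->
  (a, b) \in zip h (behead h) <->
  [/\ a \in h, b \in h, a < b & forall c, c \in h -> c <= a \/ b <= c].
Proof.
elim: h => [|u h IH] /=; first by move=> _; split=> // -[].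
case: h IH => [_ _|v h IH] /=.
  by split=> // -[]; rewrite !inE => /eqP-> /eqP->; rewrite ltxx.
move=> /andP[uv vh]; have u_lt c : c \in v :: h -> u < c.
  rewrite inE => /predU1P[->//|ch]; apply: (lt_trans uv).
  by move: vh; rewrite lt_path_sortedE => /andP[/allP/(_ _ ch)].
have {}IH := IH vh; rewrite in_cons xpair_eqE; split.
  case/orP=> [/andP[/eqP-> /eqP->]|/IH[ah bh ab abP]].
    split=> //; rewrite ?inE ?eqxx ?orbT // => c; rewrite in_cons => /predU1P[->|]; first by left.
    rewrite inE => /predU1P[->|ch]; first by right.
    by right; move: vh; rewrite lt_path_sortedE => /andP[/allP/(_ _ ch)/ltW].
  split=> //; rewrite 1?inE ?ah ?bh ?orbT // => c; rewrite inE => /predU1P[->|]; last exact: abP.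
  by left; exact/ltW/u_lt.
move=> [+ + ab abP]; rewrite inE => /predU1P[a_u|ah].
  rewrite a_u eqxx inE => /predU1P[bu|bh].
    by move: ab; rewrite a_u bu ltxx.
  have [|vu|bv] := abP v; first by rewrite !inE eqxx orbT.
    by move: vu; rewrite a_u leNgt uv.
  have -> : b = v; last by rewrite eqxx.
  apply/le_anti/andP; split=> //; move: bh; rewrite inE => /predU1P[->//|bh].
  by move: vh; rewrite lt_path_sortedE => /andP[/allP/(_ _ bh)/ltW].
rewrite inE => /predU1P[bu|bh].
  by move: ab; rewrite bu ltNge ltW // u_lt.
apply/orP; right; apply/IH; split=> // c ch; apply: abP.
by rewrite inE ch orbT.
Qed.

(** Serves to identify two families of children as lists, because [position] depends on their
    order. *)
Lemma sorted_zip_behead h : sorted <%R h ->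
  sorted (fun D E : K * K => D.1 < E.1) (zip h (behead h)).
Proof.
elim: h => // u [|v h] //= IH /andP[uv vh].
by case: h IH vh => [|w h] //= IH /andP[vw wh]; rewrite uv IH // vw.
Qed.

Lemma straddling_pair h x a0 b0 : a0 \in h -> b0 \in h -> a0 <= x -> x < b0 ->
  exists D : K * K, [/\ D.1 \in h, D.2 \in h, D.1 <= x < D.2 &
    forall c, c \in h -> c <= D.1 \/ D.2 <= c].
Proof.
move=> ah bh ax xb.
have /mem_greatest[a] : a0 \in [seq c <- h | c <= x] by rewrite mem_filter ax.
rewrite mem_filter => /andP[ax' ah'] amax.
have /(@mem_greatest _ K^d)[b] : b0 \in [seq c <- h | x < c].
  by rewrite mem_filter xb.
rewrite mem_filter => /andP[xb' bh'] bmin.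
exists (a, b); split=> //=; first by rewrite ax'.
move=> c ch; have [cx|xc] := leP c x; [left|right].
  by apply: amax; rewrite mem_filter cx.
by apply: bmin; rewrite mem_filter xc.
Qed.

End ConsecutivePairs.

(** * Net intervals and the essential class *)

Section DigitExpansions.
Set Implicit Arguments.
Unset Strict Implicit.
Unset Printing Implicit Defensive.
Variables m R : nat.
Hypotheses (hR : (2 <= R)%N) (hm : (R <= m)%N).

(* The intervals [S_s([0, 1])] with [s] of length n are the
   [[k * step, k * step + R ^- n]], where [step = (R - 1) / m * R ^- n] and
   [0 <= k <= kmax n]; the index [k] of [s] is [code s]. *)
Fixpoint kmax (n : nat) : nat := if n is n'.+1 then (R * kmax n' + m)%N else 0%N.

Definition code (s : seq 'I_m.+1) : nat :=
  foldl (fun a (j : 'I_m.+1) => (a * R + j)%N) 0%N s.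

Lemma code_rcons s j : code (rcons s j) = (code s * R + j)%N.
Proof. by rewrite /code foldl_rcons. Qed.

Lemma code_le s : (code s <= kmax (size s))%N.
Proof.
elim/last_ind: s => // s j IH; rewrite code_rcons size_rcons /= mulnC.
by rewrite leq_add ?leq_mul2l ?IH ?orbT // -ltnS.
Qed.

(** A remainder modulo R is a digit because R <= m. Where the quotient could exceed [kmax n], it is
    replaced by [kmax n], and what is left is at most m. Hence the range of indices has no gap. *)
Lemma digit_split n l : (l <= kmax n.+1)%N ->
  exists k j, [/\ (k <= kmax n)%N, (j < m.+1)%N & l = (k * R + j)%N].
Proof.
move=> /= lk; have [lle|lgt] := leqP l (R * kmax n).
  exists (l %/ R)%N, (l %% R)%N; rewrite -divn_eq; split=> //.
    by rewrite -(mulKn (kmax n) (ltnW hR)) leq_div2r.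
  by have := ltn_pmod l (ltnW hR); lia.
by exists (kmax n), (l - R * kmax n)%N; split; lia.
Qed.

Lemma code_surj n k : (k <= kmax n)%N -> exists s : n.-tuple 'I_m.+1, code s = k.
Proof.
elim: n k => [|n IH] k; first by rewrite leqn0 => /eqP->; exists [tuple].
move=> /digit_split[l [j [/IH[s sl] jm ->]]].
by exists [tuple of rcons s (Ordinal jm)]; rewrite /= code_rcons sl.
Qed.

End DigitExpansions.

(** * Net points and net intervals in terms of indices *)

Section NetStructure.
Set Implicit Arguments.
Unset Strict Implicit.
Unset Printing Implicit Defensive.
Variables (K : realType) (m R : nat).
Hypotheses (hR : (2 <= R)%N) (hm : (R <= m)%N).

Local Notation kmax := (kmax m R).
Local Notation code := (code R).

Let rho : K := R%:R^-1.
Let S := @ifs K m R.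
(** The spacing of consecutive left ends at one level, relative to the length of the intervals. It
    is less than 1 since R <= m, so consecutive intervals overlap. *)
Let d : K := (R%:R - 1) / m%:R.
Let L (n : nat) : K := rho ^+ n.
Let step (n : nat) : K := d * L n.

Let left_end (n k : nat) : K := k%:R * step n.

Let R_gt0 : 0 < R%:R :> K. Proof. by rewrite ltr0n; lia. Qed.
Let R_ge2 : 2 <= R%:R :> K. Proof. by rewrite ler_nat. Qed.
Let m_ge : R%:R <= m%:R :> K. Proof. by rewrite ler_nat. Qed.
Let rho_gt0 : 0 < rho. Proof. by rewrite invr_gt0. Qed.
Let L_gt0 n : 0 < L n. Proof. exact: exprn_gt0. Qed.
Let L0 : L 0 = 1. Proof. exact: expr0. Qed.
Let LS n : L n = R%:R * L n.+1.
Proof. by rewrite /L exprS mulrA divff ?mul1r // gt_eqF. Qed.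

Let d_gt0 : 0 < d. Proof. by have h1 := m_ge; have h2 := R_ge2; rewrite divr_gt0 //; lra. Qed.
Let d_lt1 : d < 1. Proof. by have h1 := m_ge; have h2 := R_ge2; rewrite ltr_pdivrMr; lra. Qed.
Let dm : d * m%:R = R%:R - 1. Proof. by have h1 := m_ge; have h2 := R_ge2; rewrite divfK // gt_eqF //; lra. Qed.

Let step_gt0 n : 0 < step n. Proof. exact: mulr_gt0. Qed.
Let step_lt n : step n < L n. Proof. by rewrite /step gtr_pMl. Qed.
Let stepS n : step n = R%:R * step n.+1.
Proof. by rewrite /step LS mulrCA. Qed.

Let ifsE j x : S j x = rho * x + j%:R * d * rho.
Proof. by have h1 := m_ge; have h2 := R_ge2; rewrite /S /ifs /d /rho; field; rewrite !gt_eqF //; lra. Qed.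

(** The induction is on the last letter, whose map is applied first. As [step n = R * step n.+1],
    appending the letter j turns the index k into k R + j. *)
Lemma word_mapE s x :
  word_map S s x = left_end (size s) (code s) + L (size s) * x.
Proof.
elim/last_ind: s x => [|s j IH] x.
  by rewrite /left_end /= L0 mul0r mul1r add0r.
rewrite /word_map foldr_rcons -/(word_map _ _ _) IH code_rcons size_rcons.
rewrite /left_end natrD natrM ifsE /step /L exprSr.
have := mulfV (lt0r_neq0 R_gt0); rewrite -/rho => E.
have -> : (code s)%:R * (d * rho ^+ size s) =
  (code s)%:R * (d * rho ^+ size s) * (R%:R * rho) by rewrite E mulr1.
ring.
Qed.

Let kmaxE n : left_end n (kmax n) = 1 - L n.
Proof.
elim: n => [|n IH]; first by rewrite /left_end L0 mul0r subrr.
rewrite /left_end /= natrD natrM mulrDl -mulrA mulrCA -stepS.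
rewrite -/(left_end n _) IH /step mulrA (mulrC _ d) dm LS; ring.
Qed.

Definition net_point (n : nat) (y : K) :=
  exists2 k, (k <= kmax n)%N & y = left_end n k \/ y = left_end n k + L n.

Lemma mem_net_points n y : y \in net_points S n <-> net_point n y.
Proof.
have wm (s : n.-tuple 'I_m.+1) x :
    word_map S s x = left_end n (code s) + L n * x.
  by rewrite word_mapE size_tuple.
rewrite mem_sort mem_undup mem_cat; split.
  by case/orP => /mapP[s _ ->]; (exists (code s);
    first by have := code_le R s; rewrite size_tuple);
    rewrite wm ?mulr0 ?mulr1 ?addr0; [left|right].
case=> k kn yk; have [s sk] := code_surj hR hm kn.
case: yk => ->; apply/orP; [left|right]; apply/mapP; exists s;
  by rewrite ?mem_enum // wm sk ?mulr0 ?addr0 ?mulr1.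
Qed.

Lemma sorted_net_points n : sorted <%R (net_points S n).
Proof. by rewrite lt_sorted_uniq_le sort_uniq undup_uniq sort_le_sorted. Qed.

Lemma net_point0 n : net_point n 0.
Proof. by exists 0%N => //; left; rewrite /left_end mul0r. Qed.

Lemma net_point1 n : net_point n 1.
Proof. by exists (kmax n) => //; right; rewrite kmaxE subrK. Qed.

Let left_end_le n k : (k <= kmax n)%N -> 0 <= left_end n k <= 1 - L n.
Proof.
move=> kn; rewrite -kmaxE mulr_ge0 ?(ltW (step_gt0 n)) //=.
by rewrite ler_pM2r // ler_nat.
Qed.

Lemma net_point_itv n y : net_point n y -> 0 <= y <= 1.
Proof.
by move=> [k /left_end_le/andP[? ?]] [->|->]; have := L_gt0 n => ?; apply/andP; split; lra.
Qed.

(** A left end survives through the digit 0 and a right end through the digit m, because these maps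
    fix 0 and 1 respectively. *)
Lemma net_pointS n y : net_point n y -> net_point n.+1 y.
Proof.
case=> k kn [->|->].
  exists (R * k)%N; first by rewrite /=; nia.
  by left; rewrite /left_end stepS natrM; ring.
exists (R * k + m)%N; first by rewrite /=; nia.
right; rewrite /left_end stepS natrD natrM LS mulrDl.
have -> : m%:R * step n.+1 = (R%:R - 1) * L n.+1 by rewrite -dm /step; ring.
ring.
Qed.

Lemma mem_net_intervals n (D : K * K) : D \in net_intervals S n <->
  [/\ net_point n D.1, net_point n D.2, D.1 < D.2 &
      forall c, net_point n c -> c <= D.1 \/ D.2 <= c].
Proof.
case: n => [|n]; last first.
  case: D => a b; rewrite [net_intervals _ _]/=.
  apply: (iff_trans (mem_zip_behead _ _ (sorted_net_points _))).
  by split=> -[/mem_net_points ? /mem_net_points ? ? cP]; split=> // c /mem_net_points/cP.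
(* Level 0 has a separate definition, but its only net points are 0 and 1, so the same description
   applies. *)
have np0 c : net_point 0 c -> c = 0 \/ c = 1.
  case=> k; rewrite leqn0 => /eqP->; rewrite /left_end mul0r L0 add0r.
  by case; [left|right].
rewrite inE; split=> [/eqP->|] /=.
  split=> //; [exact: net_point0|exact: net_point1|].
  by move=> c /np0[]->; [left|right].
case: D => a b /= [/np0[]-> /np0[]->]; rewrite ?ltxx ?ltr10 //.
Qed.


Lemma subset_net_point n l y : (n <= l)%N -> net_point n y -> net_point l y.
Proof. by move=> /subnK <-; elim: (l - n)%N => // k IH /IH; exact: net_pointS. Qed.

Lemma net_interval_eq n x (D E : K * K) :
  D \in net_intervals S n -> E \in net_intervals S n ->
  D.1 <= x < D.2 -> E.1 <= x < E.2 -> D = E.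
Proof.
move=> /mem_net_intervals[D1 D2 _ DP] /mem_net_intervals[E1 E2 _ EP].
move: D E D1 D2 DP E1 E2 EP => [a b] [a' b'] /= D1 D2 DP E1 E2 EP.
move=> /andP[ax xb] /andP[ax' xb'].
have := DP _ E1; have := DP _ E2; have := EP _ D1; have := EP _ D2.
by move=> [?|?] [?|?] [?|?] [?|?]; try (by exfalso; lra); (have -> : a = a' by lra); have -> : b = b' by lra.
Qed.

Lemma exists_net_interval n x : 0 <= x -> x < 1 ->
  exists2 D, D \in net_intervals S n & D.1 <= x < D.2.
Proof.
move=> x0 x1.
have [||D [D1 D2 xD DP]] := @straddling_pair _ (net_points S n) x 0 1 _ _ x0 x1.
- exact/mem_net_points/net_point0.
- exact/mem_net_points/net_point1.
exists D => //; apply/mem_net_intervals; split.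
- exact/mem_net_points.
- exact/mem_net_points.
- by case/andP: xD; apply: le_lt_trans.
- by move=> c /mem_net_points/DP.
Qed.

(** The half-open condition selects the right one of two net intervals that share the endpoint [x].
    The default [(0, 1)] is not reached for 0 <= x < 1. *)
Definition cell_at (n : nat) (x : K) : K * K :=
  xget (0, 1) [set D | D \in net_intervals S n /\ D.1 <= x < D.2].

Lemma cell_atP n x : 0 <= x -> x < 1 ->
  cell_at n x \in net_intervals S n /\ (cell_at n x).1 <= x < (cell_at n x).2.
Proof.
move=> x0 x1; have [D DF Dx] := exists_net_interval n x0 x1.
by apply: (@xgetPex _ (0, 1) [set D | D \in net_intervals S n /\ D.1 <= x < D.2]); exists D.
Qed.

Lemma net_interval_bounds n D : D \in net_intervals S n ->
  [/\ 0 <= D.1, D.1 < D.2 & D.2 <= 1].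
Proof.
by case/mem_net_intervals => /net_point_itv/andP[? ?] /net_point_itv/andP[? ?] ?.
Qed.

Lemma cell_at_eq n x D : D \in net_intervals S n -> D.1 <= x < D.2 ->
  cell_at n x = D.
Proof.
move=> DF /andP[Dx xD]; have [D1 D12 D2] := net_interval_bounds DF.
have [CF Cx] := @cell_atP n x (le_trans D1 Dx) (lt_le_trans xD D2).
by apply: (net_interval_eq CF DF Cx); rewrite Dx.
Qed.

Lemma cell_at_nested n l x : (n <= l)%N -> 0 <= x -> x < 1 ->
  (cell_at n x).1 <= (cell_at l x).1 /\ (cell_at l x).2 <= (cell_at n x).2.
Proof.
move=> nl x0 x1.
have [/mem_net_intervals[a1 b1 _ _] /andP[? ?]] := cell_atP n x0 x1.
have [/mem_net_intervals[_ _ _ P] /andP[? ?]] := cell_atP l x0 x1.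
have := P _ (subset_net_point nl a1); have := P _ (subset_net_point nl b1).
by move=> [?|?] [?|?]; split; lra.
Qed.

Let subset_cell (D E : K * K) : D.1 < D.2 ->
  cell D `<=` cell E <-> E.1 <= D.1 /\ D.2 <= E.2.
Proof.
move=> D12; split=> [DE|[E1 E2] y]; last first.
  by rewrite /cell /= !in_itv /= => /andP[? ?]; apply/andP; split; lra.
have := DE D.1; have := DE D.2; rewrite /cell /= !in_itv /= !lexx ltW //=.
by move=> /(_ isT)/andP[_ ?] /(_ isT)/andP[? _].
Qed.

Lemma parentE n D E : D \in net_intervals S n.+1 -> E \in net_intervals S n ->
  E.1 <= D.1 -> D.2 <= E.2 -> parent S n D = E.
Proof.
move=> DF EF ED1 ED2; have [_ D12 _] := net_interval_bounds DF.
rewrite /parent; set s := (X in head D X).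
have Es : E \in s by rewrite mem_filter EF andbT; apply/asboolP/subset_cell.
(* The filtered list contains [E], so [head] does not return its default. *)
have : head D s \in s by case: s Es => //= E' s' _; rewrite mem_head.
rewrite mem_filter => /andP[/asboolP/(subset_cell _ D12)[P1 P2] PF].
by apply: (@net_interval_eq n D.1) => //; apply/andP; split; lra.
Qed.

Lemma parent_cell_at n x : 0 <= x -> x < 1 ->
  parent S n (cell_at n.+1 x) = cell_at n x.
Proof.
move=> x0 x1; have [? ?] := cell_at_nested (leqnSn n) x0 x1.
by apply: parentE => //; [have [] := cell_atP n.+1 x0 x1|have [] := cell_atP n x0 x1].
Qed.

Lemma mem_parent n D : D \in net_intervals S n.+1 ->
  [/\ parent S n D \in net_intervals S n, (parent S n D).1 <= D.1
    & D.2 <= (parent S n D).2].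
Proof.
move=> DF; have [D1 D12 D2] := net_interval_bounds DF.
have x1 : D.1 < 1 by apply: lt_le_trans D2.
have <- : cell_at n.+1 D.1 = D by apply: cell_at_eq; rewrite ?lexx.
rewrite parent_cell_at //; have [? ?] := cell_at_nested (leqnSn n) D1 x1.
by split=> //; have [] := cell_atP n D1 x1.
Qed.

Lemma mem_children n D E : E \in net_intervals S n ->
  (D \in children S n E) = [&& D \in net_intervals S n.+1, E.1 <= D.1 & D.2 <= E.2].
Proof.
move=> EF; rewrite mem_filter andbC.
have [DF|//] /= := boolP (D \in net_intervals S n.+1).
by apply/eqP/andP => [<-|[? ?]]; [have [] := mem_parent DF|apply: parentE].
Qed.

Lemma mem_neighbours n D v : D.1 < D.2 -> v \in neighbours S rho n D <->
  exists k, [/\ (k <= kmax n)%N, left_end n k <= D.1, D.2 <= left_end n k + L n &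
                v = (L n)^-1 * (D.1 - left_end n k)].
Proof.
move=> D12; rewrite mem_sort mem_undup.
have wm (s : n.-tuple 'I_m.+1) x :
    word_map S s x = left_end n (code s) + L n * x.
  by rewrite word_mapE size_tuple.
have sub (s : n.-tuple 'I_m.+1) : cell D `<=` word_map S s @` `[0, 1]%classic <->
    left_end n (code s) <= D.1 /\ D.2 <= left_end n (code s) + L n.
  have -> : word_map S s @` `[0, 1]%classic =
      cell (left_end n (code s), left_end n (code s) + L n).
    apply/seteqP; split=> y /=; rewrite /cell /= !in_itv /=.
      move=> [x]; rewrite /= in_itv /= => /andP[x0 x1] <-; rewrite wm.
      by rewrite lerDl lerD2l pmulr_rge0 // x0 ger_pMr.
    move=> /andP[ly yl]; exists ((L n)^-1 * (y - left_end n (code s))).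
      rewrite /= in_itv /= mulr_ge0 ?invr_ge0 ?subr_ge0 ?(ltW (L_gt0 n))//=.
      by rewrite ler_pdivrMl ?mulr1 ?lerBlDl.
    by rewrite wm mulVKf ?gt_eqF // subrKC.
  exact: subset_cell.
split=> [/mapP[s]|[k [kn kD1 kD2 ->]]].
  rewrite mem_filter => /andP[/asboolP/sub[s1 s2] _] ->.
  exists (code s); split=> //; first by have := code_le R s; rewrite size_tuple.
  by rewrite wm mulr0 addr0.
have [s sk] := code_surj hR hm kn; apply/mapP; exists s; last by rewrite wm sk mulr0 addr0.
by rewrite mem_filter mem_enum andbT; apply/asboolP/sub; rewrite sk.
Qed.


Let left_endS n k : left_end n k.+1 = left_end n k + step n.
Proof. by rewrite /left_end -natr1 mulrDl mul1r. Qed.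

(** Take the least index whose interval reaches [D.2]. The right end of the preceding interval is a
    net point short of [D.2], hence at most [D.1], and it exceeds the chosen left end by
    [L n - step n]. *)
Lemma leftmost_cover n D : D \in net_intervals S n -> exists k,
  [/\ (k <= kmax n)%N, left_end n k <= D.1, D.2 <= left_end n k + L n &
      k = 0%N \/ left_end n k + (L n - step n) <= D.1].
Proof.
move=> DF; have [D1 D12 D2] := net_interval_bounds DF.
have [_ _ _ DP] := (mem_net_intervals n D).1 DF.
have exk : exists k, D.2 <= left_end n k + L n by exists (kmax n); rewrite kmaxE subrK.
case: (ex_minnP exk) => k kD kmin; have kn : (k <= kmax n)%N.
  by apply: kmin; rewrite kmaxE subrK.
exists k; case: k kD kmin kn => [|k] kD kmin kn.
  by split=> //; [rewrite /left_end mul0r|left].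
have [|kD1|Dk] := DP (left_end n k + L n).
- by exists k; [exact: ltnW|right].
- have := step_lt n; rewrite left_endS in kD *.
  by move=> ?; split=> //; [lra|right; lra].
- by have := kmin _ Dk; rewrite ltnn.
Qed.

(** The mirror image: for the greatest index with left end at most [D.1], the next left end is a net
    point beyond [D.1], hence at least [D.2]. *)
Lemma rightmost_cover n D : D \in net_intervals S n -> exists k,
  [/\ (k <= kmax n)%N, left_end n k <= D.1, D.2 <= left_end n k + L n &
      k = kmax n \/ D.2 <= left_end n k + step n].
Proof.
move=> DF; have [D1 D12 D2] := net_interval_bounds DF.
have [_ _ _ DP] := (mem_net_intervals n D).1 DF.
have exk : exists k, (k <= kmax n)%N && (left_end n k <= D.1).
  by exists 0%N; rewrite /left_end mul0r.
have ubk k : (k <= kmax n)%N && (left_end n k <= D.1) -> (k <= kmax n)%N by case/andP.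
case: (ex_maxnP exk ubk) => k /andP[kn kD] kmaxi; exists k.
have [kE|kN] := eqVneq k (kmax n).
  by split=> //; [rewrite kE kmaxE subrK|left].
have kn1 : (k < kmax n)%N by rewrite ltn_neqAle kN.
have [|kD1|Dk] := DP (left_end n k.+1); first by exists k.+1 => //; left.
  by have := kmaxi k.+1; rewrite kn1 kD1 ltnn => /(_ isT).
by rewrite left_endS in Dk; have := step_lt n; split=> //; [lra|right].
Qed.

Lemma net_interval_length n D : D \in net_intervals S n -> D.2 <= D.1 + L n.
Proof. by case/leftmost_cover => k [_ ? ? _]; lra. Qed.

Let L_expr n : R%:R ^+ n * L n = 1.
Proof. by rewrite -exprMn divff ?expr1n // gt_eqF. Qed.

Lemma kmax_scaled n : (kmax n)%:R * d = R%:R ^+ n - 1.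
Proof.
have -> : (kmax n)%:R * d = R%:R ^+ n * left_end n (kmax n).
  rewrite (_ : R%:R ^+ n * _ = (kmax n)%:R * d * (R%:R ^+ n * L n)).
    by rewrite L_expr mulr1.
  by rewrite /left_end /step; ring.
by rewrite kmaxE mulrBr mulr1 L_expr.
Qed.

(** For a word s of index k the number R^n x - k d is the preimage of x under S_s, so the bounds say
    that x lies in S_s([0, 1]). *)
Lemma covering_index n x : 0 <= x -> x < 1 -> exists k,
  [/\ (k <= kmax n)%N, 0 <= R%:R ^+ n * x - k%:R * d & R%:R ^+ n * x - k%:R * d <= 1].
Proof.
move=> x0 x1; have [DF /andP[D1 D2]] := cell_atP n x0 x1.
have [k [kn kD1 kD2 _]] := leftmost_cover DF; exists k.
have Rn : 0 <= R%:R ^+ n :> K by rewrite exprn_ge0 // ltW.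
have E : R%:R ^+ n * left_end n k = k%:R * d.
  rewrite (_ : R%:R ^+ n * _ = k%:R * d * (R%:R ^+ n * L n)); first by rewrite L_expr mulr1.
  by rewrite /left_end /step; ring.
split=> //.
- rewrite -E -mulrBr mulr_ge0 //; lra.
- have : R%:R ^+ n * (x - left_end n k) <= R%:R ^+ n * L n by rewrite ler_wpM2l //; lra.
  by rewrite L_expr mulrBr E.
Qed.

(* The index range 0..kmax n imposes no constraint inside
   [L n - step n, 1 - (L n - step n)]: an interval of length [L n] with left
   end in [step n * Z] that meets its interior is of the form [S_s([0, 1])]. *)
Definition interior (n : nat) (D : K * K) : Prop :=
  L n - step n <= D.1 /\ D.2 <= 1 - (L n - step n).

(** Here [c.1.1] is the normalised length and [c.1.2] the neighbour set. The first condition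
    concerns the leftmost covering interval, the second the rightmost one. *)
Definition interior_vector (c : charvec K) : Prop :=
  (exists2 v, v \in c.1.2 & 1 - d <= v) /\
  (exists2 v, v \in c.1.2 & v + c.1.1 <= d).

(** All left ends lie in [0, 1 - L n], so the two neighbours keep [D] away from 0 and 1. Conversely,
    the extreme covering intervals provide the neighbours; if such an interval has index 0 or
    [kmax n], interiority itself gives the required distance. *)
Lemma interior_vectorP n D : D \in net_intervals S n ->
  interior_vector (char_vector S rho n D) <-> interior n D.
Proof.
case: n => [|n] DF.
  (* At level 0 both sides fail, since 1 - d > 0. *)
  split=> [[[v]]|[]]; first by rewrite inE => /eqP-> ?; exfalso; have := d_lt1; lra.
  move: DF; rewrite inE => /eqP-> /=; rewrite /step L0 => ?.
  by exfalso; have := d_lt1; lra.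
have [D1 D12 D2] := net_interval_bounds DF.
have L1 := L_gt0 n.+1; have Lneq0 : L n.+1 != 0 by rewrite gt_eqF.
have scale x y : (L n.+1)^-1 * x <= y <-> x <= y * L n.+1.
  by rewrite ler_pdivrMl // mulrC.
have scale' x y : y <= (L n.+1)^-1 * x <-> y * L n.+1 <= x.
  by rewrite ler_pdivlMl // mulrC.
have lenE k : (L n.+1)^-1 * (D.1 - left_end n.+1 k) + norm_length rho n.+1 D =
  (L n.+1)^-1 * (D.2 - left_end n.+1 k).
  by rewrite /norm_length -/(L n.+1); ring.
have NB v := @mem_neighbours n.+1 D v D12.
split=> [[[v /NB[k [kn kD kD2 ->]] vP]
          [u /NB[l [ln lD lD2 ->]] uP]]|[i1 i2]].
  move: vP uP; rewrite /= lenE => /scale' vP /scale uP.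
  have /andP[k0 _] := left_end_le kn; have /andP[_ l1] := left_end_le ln.
  by rewrite /interior /step; split; lra.
split.
  have [k [kn kD kD2 kP]] := leftmost_cover DF.
  exists ((L n.+1)^-1 * (D.1 - left_end n.+1 k)); first by apply/NB; exists k.
  apply/scale'; rewrite /step in i1 kP; case: kP => [k0|]; last by lra.
  by rewrite /left_end k0 mul0r; lra.
have [k [kn kD kD2 kP]] := rightmost_cover DF.
exists ((L n.+1)^-1 * (D.1 - left_end n.+1 k)); first by apply/NB; exists k.
rewrite /= lenE; apply/scale; rewrite -/(step n.+1).
case: kP => [k0|]; last by lra.
by rewrite k0 kmaxE; lra.
Qed.

(** The margin [L n - step n] equals (1 - d) [L n], which decreases in n. *)
Lemma interior_sub n l D E : (n <= l)%N -> interior n E -> E.1 <= D.1 -> D.2 <= E.2 ->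
  interior l D.
Proof.
move=> nl [E1 E2] ED1 ED2.
suff : L l - step l <= L n - step n by rewrite /interior; split; lra.
have eE k : L k - step k = (1 - d) * L k by rewrite /step; ring.
rewrite !eE ler_pM2l ?subr_gt0 //.
rewrite -(subnK nl); elim: (l - n)%N => // k; apply: le_trans.
by rewrite addSn (LS (k + n)); have := L_gt0 (k + n).+1; have := R_ge2; nra.
Qed.


(** By [word_mapE] this is S_s for any word s of length [n0] and index [k0]. *)
Definition place (n0 k0 : nat) (y : K) : K := left_end n0 k0 + L n0 * y.

Definition place_cell n0 k0 (D : K * K) : K * K := (place n0 k0 D.1, place n0 k0 D.2).

Let LD n0 n : L (n0 + n) = L n0 * L n. Proof. exact: exprD. Qed.
Let stepD n0 n : step (n0 + n) = L n0 * step n.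
Proof. by rewrite /step LD mulrCA. Qed.

Let place_left_end n0 k0 n k :
  place n0 k0 (left_end n k) = left_end (n0 + n) (k0 * R ^ n + k).
Proof.
rewrite /place /left_end natrD natrM natrX mulrDl stepD.
suff -> : step n0 = R%:R ^+ n * (L n0 * step n) by ring.
rewrite -stepD; elim: n {k} => [|n IH]; first by rewrite addn0 mul1r.
by rewrite IH addnS stepS exprSr mulrA.
Qed.

Let ler_place n0 k0 x y : (place n0 k0 x <= place n0 k0 y) = (x <= y).
Proof. by rewrite lerD2l ler_pM2l. Qed.

Let ltr_place n0 k0 x y : (place n0 k0 x < place n0 k0 y) = (x < y).
Proof. by rewrite ltrD2l ltr_pM2l. Qed.

Let place_inj n0 k0 : injective (place n0 k0).
Proof. by move=> x y /addrI/mulfI; apply; rewrite gt_eqF. Qed.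

Let placeD n0 k0 n x : place n0 k0 (x + L n) = place n0 k0 x + L (n0 + n).
Proof. by rewrite /place mulrDr addrA LD. Qed.

Let left_end_ltS n k l : (left_end n k < left_end n l + step n) = (k <= l)%N.
Proof. by rewrite -left_endS ltr_pM2r // ltr_nat. Qed.

(** * Similar copies of interior net intervals *)

Section Place.
Variables n0 k0 : nat.
Hypothesis k0n : (k0 <= kmax n0)%N.

Let kmaxD n k : (k <= kmax n)%N -> (k0 * R ^ n + k <= kmax (n0 + n))%N.
Proof.
move=> kn; rewrite -(left_end_ltS (n0 + n)) kmaxE -place_left_end /place LD stepD.
have /andP[_ ?] := left_end_le k0n; have /andP[_ ?] := left_end_le kn.
have := L_gt0 n0; have := step_gt0 n; nra.
Qed.

(** The placed index is k0 R^n + l for an integer l with y = l [step n]. The bounds on [y] leave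
    less than one step of room at either end, which forces 0 <= l <= [kmax n]. *)
Let place_preimage n k y : place n0 k0 y = left_end (n0 + n) k ->
  - step n < y -> y < left_end n (kmax n) + step n ->
  exists l, [/\ (l <= kmax n)%N, k = (k0 * R ^ n + l)%N & y = left_end n l].
Proof.
move=> yk y_gt y_lt; have [klt|kge] := ltnP k (k0 * R ^ n).
  have : place n0 k0 (- step n) < place n0 k0 y by rewrite ltr_place.
  have -> : place n0 k0 (- step n) = left_end (n0 + n) (k0 * R ^ n) - step (n0 + n).
    rewrite -[X in left_end _ X]addn0 -place_left_end /place {3}/left_end mul0r.
    by rewrite stepD; ring.
  rewrite yk ltrBlDr left_end_ltS => ?; lia.
have kE : k = (k0 * R ^ n + (k - k0 * R ^ n))%N by lia.
exists (k - k0 * R ^ n)%N; move: yk; rewrite {1 3}kE -place_left_end => /place_inj yE.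
by split=> //; rewrite -(left_end_ltS n) -yE.
Qed.

Lemma net_point_place n y : net_point n y -> net_point (n0 + n) (place n0 k0 y).
Proof.
by case=> k kn yk; exists (k0 * R ^ n + k)%N; [exact: kmaxD|];
  rewrite -place_left_end -placeD; case: yk => ->; [left|right].
Qed.

(** The margin is just what [place_preimage] asks for: the upper bound serves left ends, and the
    lower bound serves right ends, whose interval starts at [y - L n]. *)
Lemma net_point_place_inv n y : L n - step n < y -> y < 1 - (L n - step n) ->
  net_point (n0 + n) (place n0 k0 y) -> net_point n y.
Proof.
move=> y1 y2 [k kn]; have := L_gt0 n; have := step_lt n => sL L1.
case=> [yk|yk].
  have [||l [ln _ ->]] := place_preimage yk; [lra|rewrite kmaxE; lra|].
  by exists l => //; left.
have yk' : place n0 k0 (y - L n) = left_end (n0 + n) k.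
  by apply: (@addIr _ (L (n0 + n))); rewrite -yk -placeD subrK.
have [||l [ln _ yl]] := place_preimage yk'; [lra|rewrite kmaxE; lra|].
by exists l => //; right; rewrite -yl subrK.
Qed.

Lemma place_net_interval n D : D \in net_intervals S n -> interior n D ->
  place_cell n0 k0 D \in net_intervals S (n0 + n).
Proof.
move=> /mem_net_intervals[D1 D2 D12 DP] [E1 E2]; apply/mem_net_intervals; split.
- exact: net_point_place.
- exact: net_point_place.
- by rewrite ltr_place.
move=> c cP; pose y := (L n0)^-1 * (c - left_end n0 k0).
have cE : c = place n0 k0 y by rewrite /place /y mulVKf ?gt_eqF // subrKC.
rewrite cE !ler_place; move: (DP y); have [y1|y1] := leP y D.1; first by move=> _; left.
have [y2|y2] := leP D.2 y; first by move=> _; right.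
by apply; apply: net_point_place_inv; rewrite -?cE //; lra.
Qed.

Lemma place_norm_length n D :
  norm_length rho (n0 + n) (place_cell n0 k0 D) = norm_length rho n D.
Proof.
rewrite /norm_length -/(L n) -/(L (n0 + n)) LD /place_cell /place /=.
by field; rewrite !gt_eqF.
Qed.

Lemma place_neighbours n D : D \in net_intervals S n -> interior n D ->
  neighbours S rho (n0 + n) (place_cell n0 k0 D) = neighbours S rho n D.
Proof.
move=> DF [E1 E2]; have [D1 D12 D2] := net_interval_bounds DF.
have pD12 : (place_cell n0 k0 D).1 < (place_cell n0 k0 D).2 by rewrite ltr_place.
have vE x : (L (n0 + n))^-1 * (place n0 k0 D.1 - place n0 k0 x) = (L n)^-1 * (D.1 - x).
  by rewrite LD /place; field; rewrite !gt_eqF.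
apply: lt_sorted_eq.
- by rewrite lt_sorted_uniq_le sort_uniq undup_uniq sort_le_sorted.
- by rewrite lt_sorted_uniq_le sort_uniq undup_uniq sort_le_sorted.
move=> v; apply/idP/idP.
  move=> /(mem_neighbours _ _ pD12)[k [kn kD1 kD2 ->]].
  pose y := (L n0)^-1 * (left_end (n0 + n) k - left_end n0 k0).
  have yk : place n0 k0 y = left_end (n0 + n) k.
    by rewrite /place /y mulVKf ?gt_eqF // subrKC.
  move: kD1 kD2; rewrite -yk -placeD !ler_place => kD1 kD2.
  have [||l [ln _ yl]] := place_preimage yk; [lra|rewrite kmaxE; lra|].
  by apply/(mem_neighbours _ _ D12); exists l; rewrite -yl; split.
move=> /(mem_neighbours _ _ D12)[k [kn kD1 kD2 ->]].
apply/(mem_neighbours _ _ pD12); exists (k0 * R ^ n + k)%N.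
by rewrite -place_left_end -placeD !ler_place vE; split=> //; exact: kmaxD.
Qed.

(** An equality of lists, not only of sets: both sides are sorted by left endpoint and have the same
    members. *)
Lemma place_children n E : E \in net_intervals S n -> interior n E ->
  children S (n0 + n) (place_cell n0 k0 E) = map (place_cell n0 k0) (children S n E).
Proof.
move=> EF Ei; have pEF := place_net_interval EF Ei.
have [E1 E12 E2] := net_interval_bounds EF.
have srt l D : sorted (fun D E : K * K => D.1 < E.1) (children S l D).
  apply: sorted_filter; first by move=> ? ? ?; apply: lt_trans.
  exact/sorted_zip_behead/sorted_net_points.
have childi D : D \in children S n E -> D \in net_intervals S n.+1 /\ interior n.+1 D.
  rewrite mem_children // => /and3P[DF D1 D2]; split=> //.
  exact: interior_sub (leqnSn n) Ei D1 D2.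
apply: (@irr_sorted_eq _ (fun D E : K * K => D.1 < E.1)) => //.
- by move=> ? ? ?; apply: lt_trans.
- rewrite sorted_map; apply: (@sub_sorted _ _ _ _ _ (srt n E)) => D D' /=.
  by rewrite ltr_place.
move=> C; apply/idP/mapP; last first.
  move=> [D DE ->]; have [DF Di] := childi D DE; move: DE.
  rewrite !mem_children // => /and3P[_ D1 D2].
  by rewrite -addnS place_net_interval // !ler_place D1.
(* Pull the left end of [C] back to [x]. The copy of the cell at [x] and [C] are net intervals of
   the same level containing [C.1], so they coincide. *)
rewrite mem_children // => /and3P[CF C1 C2]; have [_ C12 _] := net_interval_bounds CF.
pose x := (L n0)^-1 * (C.1 - left_end n0 k0).
have xC : place n0 k0 x = C.1 by rewrite /place /x mulVKf ?gt_eqF // subrKC.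
have Ex : E.1 <= x by move: C1; rewrite /= -xC ler_place.
have xE : x < E.2.
  have : place n0 k0 x < place n0 k0 E.2 by rewrite xC; apply: lt_le_trans C2.
  by rewrite ltr_place.
have x0 : 0 <= x by apply: le_trans Ex. have x1 : x < 1 by apply: lt_le_trans E2.
have [DF /andP[D1 D2]] := cell_atP n.+1 x0 x1.
have [DE1 DE2] := cell_at_nested (leqnSn n) x0 x1.
have EE : cell_at n x = E by apply: cell_at_eq; rewrite // Ex.
have DE : cell_at n.+1 x \in children S n E.
  by rewrite mem_children // DF -EE DE1.
exists (cell_at n.+1 x) => //; apply: (@net_interval_eq (n0 + n).+1 C.1).
- exact: CF.
- by rewrite -addnS; have [? ?] := childi _ DE; apply: place_net_interval.
- by rewrite lexx.
- by rewrite -xC ler_place ltr_place D1.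
Qed.

(** Length and neighbours only need [D] to be interior, but [position] compares [D] with all its
    siblings. This is why the parent has to be interior, here and in [interior_class]. *)
Lemma place_char_vector n D : D \in net_intervals S n.+1 ->
  interior n (parent S n D) ->
  char_vector S rho (n0 + n.+1) (place_cell n0 k0 D) = char_vector S rho n.+1 D.
Proof.
move=> DF Ei; have [EF E1 E2] := mem_parent DF.
have Di : interior n.+1 D by apply: interior_sub Ei _ _.
have pDF := place_net_interval DF Di.
have parE : parent S (n0 + n) (place_cell n0 k0 D) = place_cell n0 k0 (parent S n D).
  by rewrite addnS in pDF; apply: parentE; rewrite ?ler_place ?place_net_interval.
rewrite {1}addnS /char_vector -addnS place_norm_length place_neighbours //.
congr (_, _, _); rewrite addnS /position parE place_children // -addnS.
rewrite filter_map index_map; last by move=> [? ?] [? ?] [/place_inj-> /place_inj->].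
congr (index _ _).+1; apply: eq_in_filter => C /=.
rewrite mem_children // => /and3P[CF C1 C2].
have Ci : interior n.+1 C by apply: interior_sub Ei C1 C2.
by rewrite !place_norm_length !place_neighbours.
Qed.

End Place.

(** * Identification of the essential class *)

Definition interior_class : set (charvec K) :=
  [set c | exists n D, [/\ D \in net_intervals S n.+1, interior n (parent S n D) &
                           c = char_vector S rho n.+1 D]].

Let cv_at n x := char_vector S rho n (cell_at n x).

Let is_child_cv_at n x : 0 <= x -> x < 1 -> is_child S rho (cv_at n.+1 x) (cv_at n x).
Proof.
move=> x0 x1; exists n, (cell_at n.+1 x).
by rewrite parent_cell_at //; have [] := cell_atP n.+1 x0 x1.
Qed.

Let Omega_cv_at n x : 0 <= x -> x < 1 -> Omega S rho (cv_at n x).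
Proof. by move=> x0 x1; exists n, (cell_at n x); have [] := cell_atP n x0 x1. Qed.

Let small_L e : 0 < e -> exists N, forall n, (N <= n)%N -> L n < e.
Proof.
move=> e0; exists (Num.bound e^-1) => n /upper_nthrootP en.
rewrite /L /rho exprVn invf_plt ?posrE ?exprn_gt0 //.
by apply: (lt_le_trans en); rewrite lerXn2r ?nnegrE ?ler0n.
Qed.

Lemma interior_cell_at x : 0 < x -> x < 1 ->
  exists N, forall n, (N <= n)%N -> interior n (cell_at n x).
Proof.
move=> x0 x1.
have [N1 P1] : exists N, forall n, (N <= n)%N -> L n < x / 2 by apply: small_L; lra.
have [N2 P2] : exists N, forall n, (N <= n)%N -> L n < (1 - x) / 2 by apply: small_L; lra.
exists (maxn N1 N2) => n; rewrite geq_max => /andP[/P1 l1 /P2 l2].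
have [/net_interval_length len /andP[? ?]] := cell_atP n (ltW x0) x1.
by have := step_gt0 n => ?; split; lra.
Qed.

Lemma interior_class_cv_at x n l : 0 <= x -> x < 1 -> (n < l)%N ->
  interior n (cell_at n x) -> interior_class (cv_at l x).
Proof.
move=> x0 x1; case: l => // l; rewrite ltnS => nl ni; exists l, (cell_at l.+1 x).
rewrite parent_cell_at //; have [? _] := cell_atP l.+1 x0 x1; split=> //.
by have [? ?] := @cell_at_nested n l x nl x0 x1; apply: interior_sub nl ni _ _.
Qed.

Lemma interior_vector_class c : interior_class c -> interior_vector c.
Proof.
move=> [n [D [DF Di ->]]]; apply/interior_vectorP => //.
by have [_ ? ?] := mem_parent DF; apply: interior_sub Di _ _.
Qed.

(** The interval that realises the child relation may differ from the one where [a] was first met;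
    interiority carries over because it is a property of the vector. *)
Lemma interior_vector_child a b : interior_vector a -> is_child S rho b a ->
  interior_class b /\ interior_vector b.
Proof.
move=> ia [n [D [DF aE bE]]]; have [EF _ _] := mem_parent DF.
suff bi : interior_class b by split=> //; exact: interior_vector_class.
by exists n, D; split=> //; apply/interior_vectorP; rewrite -?aE.
Qed.

(** Place a small copy of [D'] inside [D]. The copy has the same characteristic vector as [D'], and
    the chain of net intervals leading from [D] down to it is the desired path. *)
Lemma interior_class_connected a b : interior_class a -> interior_class b ->
  exists n g, [/\ (2 <= n)%N, admissible_path S rho n g,
    forall j, (j < n)%N -> interior_class (g j), g 0%N = a & g n.-1 = b].
Proof.
move=> [n [D [DF Di ->]]] [n' [D' [DF' Di' ->]]].
have [D1 D12 D2] := net_interval_bounds DF.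
pose x := (D.1 + D.2) / 2; have x0 : 0 <= x by rewrite /x; lra.
have x1 : x < 1 by rewrite /x; lra.
(* Intervals of such a level that contain the midpoint [x] stay inside [D]; a level above n also
   makes the path have at least two vertices. *)
have [N NP] : exists N, forall n, (N <= n)%N -> L n < (D.2 - D.1) / 2.
  by apply: small_L; lra.
have [n0 [/NP Ln0 nn0]] : exists n0, (N <= n0)%N /\ (n < n0)%N.
  by exists (maxn N n.+1); rewrite leq_maxl leq_max ltnSn orbT.
have [CF /andP[C1 C2]] := cell_atP n0 x0 x1.
have [k0 [k0n kC1 kC2 _]] := leftmost_cover CF.
have [D1' D12' D2'] := net_interval_bounds DF'.
have Di2 : interior n'.+1 D'.
  by have [_ ? ?] := mem_parent DF'; apply: interior_sub Di' _ _.
have PF := place_net_interval k0n DF' Di2.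
pose y := place n0 k0 D'.1.
have [y1 y2] : D.1 <= y /\ y < D.2.
  have := L_gt0 n0; rewrite /y /place /= => L1; move: kC1 kC2 C1 C2 Ln0; rewrite /x.
  have : 0 <= L n0 * D'.1 by rewrite mulr_ge0 // ltW.
  have : L n0 * D'.1 <= L n0 by rewrite ger_pMr // ltW // (lt_le_trans D12').
  by split; lra.
have y0 : 0 <= y by lra. have y1' : y < 1 by lra.
have yD : cell_at n.+1 y = D by apply: cell_at_eq; rewrite ?y1.
have yP : cell_at (n0 + n'.+1) y = place_cell n0 k0 D'.
  by apply: cell_at_eq; rewrite // lexx ltr_place.
(* The path runs from level [n.+1], where the cell of [y] is [D], to level [n0 + n'.+1], where it is
   the copy of [D']. *)
exists (n0 + n'.+1 - n)%N, (fun j => cv_at (n.+1 + j) y); split.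
- by clear -nn0; lia.
- split=> [j _|j _]; first exact: Omega_cv_at.
  by rewrite addnS; apply: is_child_cv_at.
- move=> j _; apply: (@interior_class_cv_at y n); rewrite ?leq_addr //.
  by rewrite -parent_cell_at // yD.
- by rewrite addn0 /cv_at yD.
- have -> : (n.+1 + (n0 + n'.+1 - n).-1 = n0 + n'.+1)%N by clear -nn0; lia.
  by rewrite /cv_at yP place_char_vector.
Qed.

Lemma essential_interior_class : essential_class S rho interior_class.
Proof.
split; last first.
  by move=> a b /interior_vector_class ia /(interior_vector_child ia)[].
split; last exact: interior_class_connected.
- by move=> _ [n [D [DF _ ->]]]; exists n.+1, D.
- have [h0 h1] : (0 : K) < 1 / 2 /\ 1 / 2 < 1 :> K by lra.
  have [N NP] := interior_cell_at h0 h1; exists (cv_at N.+1 (1 / 2)).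
  by apply: (@interior_class_cv_at _ N) => //; exact: NP.
Qed.

(** This treats every essential class without appeal to uniqueness. Descending from an interval with
    vector [c] towards its midpoint stays in [W] and becomes interior; a path in [W] leads back to
    [c], and interiority passes along it to children. *)
Lemma essential_class_interior W c : essential_class S rho W -> W c -> interior_vector c.
Proof.
move=> [[WO _ Wc] Wch] cW; have [n [D [DF cE]]] := WO _ cW.
have [D1 D12 D2] := net_interval_bounds DF.
pose x := (D.1 + D.2) / 2; have x0 : 0 < x by rewrite /x; lra.
have x1 : x < 1 by rewrite /x; lra.
have xD : cell_at n x = D by apply: cell_at_eq => //; rewrite /x; apply/andP; split; lra.
have Wx l : W (cv_at (n + l) x).
  elim: l => [|l IH]; first by rewrite addn0 /cv_at xD -cE.
  by rewrite addnS; apply: Wch IH _; apply: is_child_cv_at; rewrite ?ltW.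
have [N NP] := interior_cell_at x0 x1.
have ib : interior_vector (cv_at (n + N) x).
  apply/interior_vectorP; first by have [] := cell_atP (n + N) (ltW x0) x1.
  by apply: NP; rewrite leq_addl.
have [l [g [l2 [_ gch] _ g0 gl]]] := Wc _ _ (Wx N) cW.
rewrite -gl; have : (l.-1 < l)%N by clear -l2; lia.
elim: l.-1 => [|j IH] jl; first by rewrite g0.
by have [] := interior_vector_child (IH (ltnW jl)) (gch _ jl).
Qed.

Lemma essential_pointsE : essential_points S rho = `]0, 1[%classic.
Proof.
apply/seteqP; split=> x /=; rewrite in_itv /=; last first.
  move=> /andP[x0 x1]; exists interior_class; split; first exact: essential_interior_class.
  exists (cv_at ^~ x); split.
    exists (cell_at ^~ x) => n; have [DF /andP[D1 D2]] := cell_atP n (ltW x0) x1.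
    by rewrite parent_cell_at ?ltW // /cell /= in_itv /= D1 ltW.
  have [N NP] := interior_cell_at x0 x1; exists N.+1 => j Nj.
  by apply: (@interior_class_cv_at x N) => //; [exact: ltW|exact: NP].
move=> [W [We [g [[D DP] [N NP]]]]].
have [DF Dx _ gE] := DP N.
have /(essential_class_interior We) := NP N (leqnn N).
rewrite gE => /(interior_vectorP DF)[i1 i2].
move: Dx; rewrite /cell /= in_itv /= => /andP[? ?]; have := step_lt N.
by move=> ?; apply/andP; split; lra.
Qed.

End NetStructure.

(** * The mass of intervals *)

Section SelfSimilarMeasure.
Set Implicit Arguments.
Unset Strict Implicit.
Unset Printing Implicit Defensive.
Variables (K : realType) (m R : nat).
Hypotheses (hR : (2 <= R)%N) (hm : (R <= m)%N).
Variables (p : 'I_m.+1 -> K) (mu : probability (measurableTypeR K) K).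
Hypotheses (p_gt0 : forall j, 0 < p j) (p_sum : \sum_(j < m.+1) p j = 1).
Hypothesis mu_ss : self_similar mu (@ifs K m R) p.

Let d : K := (R%:R - 1) / m%:R.
Let p_ge0 j : 0 <= p j. Proof. exact: ltW. Qed.

Let R_gt0 : 0 < R%:R :> K. Proof. by rewrite ltr0n; lia. Qed.
Let R_ge2 : 2 <= R%:R :> K. Proof. by rewrite ler_nat. Qed.
Let m_ge : R%:R <= m%:R :> K. Proof. by rewrite ler_nat. Qed.
Let d_gt0 : 0 < d.
Proof. by have h1 := m_ge; have h2 := R_ge2; rewrite divr_gt0 //; lra. Qed.
Let dm : d * m%:R = R%:R - 1.
Proof. by have h1 := m_ge; have h2 := R_ge2; rewrite divfK // gt_eqF //; lra. Qed.
Let jd_le (j : 'I_m.+1) : 0 <= j%:R * d <= R%:R - 1.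
Proof.
rewrite mulr_ge0 ?ler0n ?(ltW d_gt0) //= -dm mulrC ler_pM2l // ler_nat.
by rewrite -ltnS.
Qed.

Definition imass (a b : K) : K := fine (mu `[a, b]%classic).
Local Notation F := imass.

Lemma imassE a b : mu `[a, b]%classic = (F a b)%:E.
Proof. by rewrite fineK // fin_num_measure //; exact: measurable_itv. Qed.

Lemma imass_ge0 a b : 0 <= F a b.
Proof. exact: fine_ge0. Qed.

Lemma imass_le a b a' b' : a' <= a -> b <= b' -> F a b <= F a' b'.
Proof.
move=> aa bb; rewrite -lee_fin -!imassE le_measure ?inE //; try exact: measurable_itv.
by move=> x /=; rewrite !in_itv /= => /andP[? ?]; apply/andP; split; lra.
Qed.

Lemma imass_le1 a b : F a b <= 1.
Proof. by rewrite -lee_fin -imassE probability_le1 //; exact: measurable_itv. Qed.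

Lemma imass_self_similar a b :
  F a b = \sum_(j < m.+1) p j * F (R%:R * a - j%:R * d) (R%:R * b - j%:R * d).
Proof.
apply: EFin_inj; rewrite -imassE mu_ss; last exact: measurable_itv.
rewrite -sumEFin; apply: eq_bigr => j _; rewrite EFinM -imassE; congr (_ * mu _)%E.
have ifsE x : ifs R j x = (x + j%:R * d) / R%:R.
  have h1 := m_ge; have h2 := R_ge2.
  by rewrite /ifs /d; field; rewrite !gt_eqF //; lra.
apply/seteqP; split=> x /=; rewrite !in_itv /= ifsE;
  rewrite ler_pdivlMr // ler_pdivrMr // mulrC (mulrC b) => /andP[? ?];
  by apply/andP; split; lra.
Qed.

(** Each preimage of [-t, 1+t] under S_j contains [-Rt, 1+Rt], so enlarging t by the factor R does
    not increase the mass. The enlarged intervals exhaust the line. *)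
Lemma imass_full t : 0 < t -> F (- t) (1 + t) = 1.
Proof.
move=> t0; apply/eqP; rewrite eq_le imass_le1 /=.
have expand s : 0 < s -> F (- (R%:R * s)) (1 + R%:R * s) <= F (- s) (1 + s).
  move=> s0; rewrite (imass_self_similar (- s)); set X := F _ _.
  have -> : X = \sum_(j < m.+1) p j * X by rewrite -mulr_suml p_sum mul1r.
  apply: ler_sum => j _; rewrite ler_wpM2l ?p_ge0 // imass_le //;
    have /andP[? ?] := jd_le j; lra.
have expandn n : F (- (R%:R ^+ n * t)) (1 + R%:R ^+ n * t) <= F (- t) (1 + t).
  elim: n => [|n IH]; first by rewrite !mul1r.
  by apply: le_trans IH; rewrite exprS -mulrA expand // mulr_gt0 // exprn_gt0.
apply/ler_addgt0Pr => e e0.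
have [n Fn] : exists n : nat, 1 - e < F (- n%:R) n%:R.
  pose A n := `[(- n%:R : K), n%:R]%classic.
  have cv : (mu \o A) n @[n --> \oo] --> mu (\bigcup_n A n).
    apply: nondecreasing_cvg_mu => [n||n l nl].
    - exact: measurable_itv.
    - by apply: bigcupT_measurable => n; exact: measurable_itv.
    - apply/subsetPset => x; rewrite /A /= !in_itv /=.
      have : n%:R <= l%:R :> K by rewrite ler_nat.
      by move=> ? /andP[? ?]; apply/andP; split; lra.
  rewrite bigcup_itvT probability_setT in cv.
  have /fine_cvgP[_ /cvgrPdist_lt/(_ e e0)[N _ /(_ N (leqnn N))]] := cv.
  rewrite /= -/(F _ _) ltr_norml => /andP[_ ?]; exists N; lra.
have [k kn] : exists k, n%:R / t < R%:R ^+ k.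
  exists (Num.bound (n%:R / t)); have := upper_nthrootP (leqnn (Num.bound (n%:R / t))).
  by move/lt_le_trans; apply; rewrite lerXn2r ?nnegrE ?ler0n.
rewrite ltr_pdivrMr // in kn.
have := expandn k; have : F (- n%:R) n%:R <= F (- (R%:R ^+ k * t)) (1 + R%:R ^+ k * t).
  by apply: imass_le; lra.
by move=> ? ?; lra.
Qed.

Lemma imass_full_itv a b : a < 0 -> 1 < b -> F a b = 1.
Proof.
move=> a0 b1; apply/eqP; rewrite eq_le imass_le1 /=.
pose t := Num.min (- a) (b - 1); have t0 : 0 < t by rewrite lt_min; apply/andP; lra.
have ta : t <= - a by rewrite ge_min lexx.
have tb : t <= b - 1 by rewrite ge_min lexx orbT.
by rewrite -(imass_full t0) imass_le //; lra.
Qed.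

(** The interval is disjoint from some [-t, 1+t], which already carries mass 1. *)
Lemma imass_eq0 a b : b < 0 \/ 1 < a -> F a b = 0.
Proof.
move=> ab; have [ba|ab'] := ltP b a.
  rewrite /imass set_itv_ge ?measure0 //; by rewrite bnd_simp -ltNge.
have [t t0 dis] : exists2 t, 0 < t & b < - t \/ 1 + t < a.
  case: ab => [b0|a1]; first by exists (- b / 2); [lra|left; lra].
  by exists ((a - 1) / 2); [lra|right; lra].
apply/eqP; rewrite eq_le imass_ge0 andbT.
have mI x y : measurable (`[x, y]%classic : set (measurableTypeR K)).
  exact: measurable_itv.
have : (mu (`[a, b]%classic `|` `[(- t)%R, (1 + t)%R]%classic) <= 1)%E.
  by apply: probability_le1; apply: measurableU.
have -> : mu (`[a, b]%classic `|` `[(- t)%R, (1 + t)%R]%classic) =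
    (mu `[a, b]%classic + mu `[(- t)%R, (1 + t)%R]%classic)%E.
  apply: measureU => //; apply/seteqP; split=> x //=.
  by rewrite !in_itv /= => -[/andP[? ?] /andP[? ?]]; case: dis => ?; lra.
by rewrite !imassE (imass_full t0) -EFinD lee_fin; lra.
Qed.

(** The total weight of the words of length n with index l, by recursion on the last letter rather
    than as a sum over words. *)
Fixpoint index_weight (n l : nat) : K :=
  if n is n'.+1 then
    \sum_(k < (kmax m R n').+1) \sum_(j < m.+1)
      (if (k * R + j == l)%N then index_weight n' k * p j else 0)
  else (l == 0%N)%:R.
Local Notation w := index_weight.

Lemma imass_expansion n a b : F a b =
  \sum_(l < (kmax m R n).+1) w n l * F (R%:R ^+ n * a - l%:R * d) (R%:R ^+ n * b - l%:R * d).
Proof.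
elim: n => [|n ->].
  by rewrite big_ord1 /= mul1r !expr0 !mul1r !mul0r !subr0.
rewrite /=; under [RHS]eq_bigr do rewrite big_distrl /=.
rewrite exchange_big /=; apply: eq_bigr => k _.
under [RHS]eq_bigr do rewrite big_distrl /=.
rewrite exchange_big /= imass_self_similar big_distrr /=; apply: eq_bigr => j _.
have lt_kj : (k * R + j < (R * kmax m R n + m).+1)%N.
  have := ltn_ord j; have := ltn_ord k; rewrite !ltnS => kn jm.
  by rewrite mulnC leq_add // leq_mul2l kn orbT.
rewrite (bigD1 (Ordinal lt_kj)) //= eqxx big1 ?addr0; last first.
  by move=> l; rewrite -val_eqE /= eq_sym => /negbTE->; rewrite mul0r.
by rewrite mulrA !exprS natrD natrM; congr (_ * F _ _); ring.
Qed.

Lemma index_weight_ge0 n l : 0 <= w n l.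
Proof.
elim: n l => [|n IH] l /=; first by case: eqP.
by apply: sumr_ge0 => k _; apply: sumr_ge0 => j _; case: ifP; rewrite ?mulr_ge0.
Qed.

(** Part of a sum of nonnegative terms. A list of parents is allowed because two of them must be
    combined when m = R. *)
Lemma index_weight_parents n l (s : seq (nat * 'I_m.+1)) :
  uniq s -> all (fun kj : nat * 'I_m.+1 => (kj.1 <= kmax m R n)%N && (kj.1 * R + kj.2 == l)%N) s ->
  \sum_(kj <- s) w n kj.1 * p kj.2 <= w n.+1 l.
Proof.
move=> us sP; rewrite /= pair_big /=.
pose f (kj : 'I_(kmax m R n).+1 * 'I_m.+1) : nat * 'I_m.+1 := (val kj.1, kj.2).
have f_inj : injective f by move=> [k j] [k' j'] [/val_inj-> ->].
have -> : \sum_(kj <- s) w n kj.1 * p kj.2 =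
    \sum_(x : 'I_(kmax m R n).+1 * 'I_m.+1 | f x \in s) w n x.1 * p x.2.
  rewrite -[RHS]big_filter; set e := (X in _ = \sum_(i <- X) _).
  rewrite (_ : \sum_(i <- e) _ = \sum_(y <- map f e) w n y.1 * p y.2); last by rewrite big_map.
  apply: perm_big; apply: uniq_perm => //.
    by rewrite map_inj_uniq // filter_uniq // index_enum_uniq.
  move=> [k j]; apply/idP/mapP => [ks|[x]]; last first.
    by rewrite mem_filter => /andP[? _] ->.
  have /= /andP[kn _] := allP sP _ ks.
  exists (inord k, j); rewrite ?mem_filter ?mem_index_enum /f /= ?inordK ?andbT //.
rewrite [leRHS](bigID (fun x => f x \in s)) /=.
rewrite -[leLHS]addr0 lerD //; last first.
  by apply: sumr_ge0 => x _; case: ifP; rewrite ?mulr_ge0 ?index_weight_ge0.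
apply: ler_sum => -[k j] /(allP sP)/= /andP[_ ->] //.
Qed.


Let index_weight_parent n k (j : 'I_m.+1) l : (k <= kmax m R n)%N ->
  (k * R + j = l)%N -> w n k * p j <= w n.+1 l.
Proof.
move=> kn kjl; have := @index_weight_parents n l [:: (k, j)] isT.
by rewrite /= big_seq1 kn kjl eqxx; apply.
Qed.

Lemma index_weight_lower (c : K) n l : 0 <= c -> (forall j, c <= p j) ->
  (l <= kmax m R n)%N -> c ^+ n <= w n l.
Proof.
move=> c0 cp; elim: n l => [|n IH] l; first by rewrite /= leqn0 => ->.
move=> /(digit_split hR hm)[k [j [kn jm ->]]].
apply: le_trans (@index_weight_parent n k (Ordinal jm) _ kn erefl).
by rewrite exprSr ler_pM // ?exprn_ge0 // IH.
Qed.

(* Away from the two extreme indices, an index has a parent through an interior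
   digit, except that for [R = m] a multiple of [R] only has its two parents
   through the digits 0 and m. *)
Lemma index_weight_step n l (c q : K) : 0 <= c -> 0 <= q ->
  q <= p ord0 + p ord_max -> (forall j, j != ord0 -> j != ord_max -> q <= p j) ->
  (0 < l)%N -> (l < kmax m R n.+1)%N ->
  (forall k (j : 'I_m.+1), (k <= kmax m R n)%N -> (k * R + j = l)%N -> c <= w n k) ->
  c * q <= w n.+1 l.
Proof.
move=> c0 q0 q2 qp l0 lmax cw; rewrite [kmax _ _ _]/= in lmax.
have inner k b : (k <= kmax m R n)%N -> (0 < b)%N -> (b < m)%N -> (k * R + b = l)%N ->
    c * q <= w n.+1 l.
  move=> kn b0 bm kbl; have bm' : (b < m.+1)%N by exact: ltnW.
  apply: le_trans (@index_weight_parent n k (Ordinal bm') _ kn kbl).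
  rewrite ler_pM //; first exact: cw (Ordinal bm') kn kbl.
  by apply: qp; rewrite -val_eqE /=; lia.
(* Beyond R [kmax n] use the parent [kmax n]: its digit is positive, and it is less than m because l
   is not the last index. *)
have [lle|lgt] := leqP l (R * kmax m R n); last first.
  by apply: (inner (kmax m R n) (l - R * kmax m R n)%N) => //; lia.
have an : (l %/ R <= kmax m R n)%N.
  by rewrite -(mulKn (kmax m R n) (ltnW hR)) leq_div2r.
have bR := ltn_pmod l (ltnW hR); have lE := divn_eq l R.
have [b0|b0] := posnP (l %% R)%N; last first.
  by apply: (inner (l %/ R)%N (l %% R)%N) => //; lia.
have a0 : (0 < l %/ R)%N by case: (l %/ R)%N lE => //; lia.
(* Borrowing 1 from the quotient replaces the digit 0 by the digit R, which is interior unless R =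
   m. *)
have lE1 : ((l %/ R).-1 * R + R = l)%N.
  by rewrite {2}lE b0 addn0 -{2}(prednK a0) mulSn addnC.
have an1 : ((l %/ R).-1 <= kmax m R n)%N by apply: leq_trans (leq_pred _) an.
have [Rm|mR] := ltnP R m.
  by apply: (inner (l %/ R).-1 R) => //; exact: ltnW.
have Rm : R = m by lia.
have P0 : (l %/ R * R + @ord0 m = l)%N by rewrite {2}lE b0.
have P1 : ((l %/ R).-1 * R + @ord_max m = l)%N by rewrite /= -Rm.
apply: le_trans (@index_weight_parents n l
  [:: ((l %/ R)%N, ord0); ((l %/ R).-1, ord_max)] _ _).
- rewrite big_cons big_seq1 /=.
  have c1 := cw _ _ an P0; have c2 := cw _ _ an1 P1.
  apply: (@le_trans _ _ (c * p ord0 + c * p ord_max)).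
    by rewrite -mulrDr ler_wpM2l.
  by rewrite lerD // ler_wpM2r // p_ge0.
- by rewrite /= inE xpair_eqE negb_and; apply/andP; split=> //; apply/orP; left; lia.
- by apply/and3P; split=> //; apply/andP; split=> //; apply/eqP.
Qed.

Lemma imass_inner_lower (q x : K) : 0 < q -> q <= p ord0 + p ord_max ->
  (forall j, j != ord0 -> j != ord_max -> q <= p j) -> 0 < x -> x < 1 ->
  exists2 c, 0 < c & exists N, forall n, (N <= n)%N ->
    c * q ^+ n <= F (x - 2 * R%:R^-1 ^+ n) (x + 2 * R%:R^-1 ^+ n).
Proof.
move=> q0 q2 qp x0 x1.
have [p0 p0_gt0 p0p] : exists2 c, 0 < c & forall j, c <= p j.
  exists (\big[Num.min/1]_j p j); last by move=> j; exact: bigmin_le.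
  by rewrite lt_bigmin.
have big (y : K) : 0 < y -> exists N, forall n, (N <= n)%N -> 1 < R%:R ^+ n * y.
  move=> y0; exists (Num.bound y^-1) => n /upper_nthrootP yn.
  rewrite -ltr_pdivrMr // div1r; apply: (lt_le_trans yn).
  by rewrite lerXn2r ?nnegrE ?ler0n.
have [N1 N1P] := big x x0; have x1' : 0 < 1 - x by lra.
have [N2 N2P] := big _ x1'; pose N := maxn N1 N2.
(* Up to level N only the crude bound by [p0] per letter is available; from then on each level costs
   at most a factor [q]. *)
exists (p0 ^+ N * q ^- N); first by rewrite mulr_gt0 ?invr_gt0 ?exprn_gt0.
exists N => n Nn.
pose y n k := R%:R ^+ n * x - k%:R * d.
have wlow i k : (k <= kmax m R (N + i))%N -> 0 <= y (N + i)%N k -> y (N + i)%N k <= 1 ->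
    p0 ^+ N * q ^+ i <= w (N + i) k.
  elim: i k => [|i IH] k kn k0 k1.
    by rewrite mulr1 addn0 in kn *; apply: index_weight_lower => //; exact: ltW.
  rewrite addnS in kn k0 k1 *; rewrite exprSr mulrA.
  have NN : (N <= (N + i).+1)%N by rewrite -addnS leq_addr.
  have y1 : 1 < R%:R ^+ (N + i).+1 * x by apply: N1P; apply: leq_trans NN; exact: leq_maxl.
  have y2 : 1 < R%:R ^+ (N + i).+1 * (1 - x).
    by apply: N2P; apply: leq_trans NN; exact: leq_maxr.
  apply: index_weight_step => //.
  - by rewrite mulr_ge0 // exprn_ge0 // ltW.
  - exact: ltW.
  (* Index 0 would give y = R^n x > 1, and the last index would give y = 1 - R^n (1 - x) < 0. *)
  - by rewrite lt0n; apply: contraTneq y1 => kk; move: k1; rewrite /y kk mul0r subr0 -leNgt.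
  - rewrite ltn_neqAle kn andbT; apply: contraTneq y2 => kk; move: k0.
    by rewrite /y kk (kmax_scaled K hR hm) -/d -leNgt mulrBr mulr1; lra.
  (* An interval containing x has only parents containing x, so the induction hypothesis applies to
     them. *)
  move=> l j ln ljk; have yE : y (N + i).+1 k = R%:R * y (N + i)%N l - j%:R * d.
    by rewrite /y -ljk exprS natrD natrM; ring.
  rewrite yE in k0 k1; have /andP[? ?] := jd_le j.
  have h2 := R_ge2; apply: IH => //; first by rewrite -(pmulr_rge0 _ R_gt0); lra.
  by rewrite -(ler_pM2l R_gt0); lra.
have [k [kn k0 k1]] := covering_index hR hm n (ltW x0) x1.
rewrite -/d -/(y n k) in k0 k1.
have wk : p0 ^+ N * q ^- N * q ^+ n <= w n k.
  rewrite -mulrA -(subnKC Nn) exprD mulKf ?expf_neq0 ?gt_eqF //.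
  by apply: wlow; rewrite ?subnKC.
apply: (le_trans wk); rewrite (imass_expansion n).
have kn' : (k < (kmax m R n).+1)%N by [].
rewrite (bigD1 (Ordinal kn')) //= -[leLHS]addr0 lerD //; last first.
  by apply: sumr_ge0 => l _; rewrite mulr_ge0 ?index_weight_ge0 ?imass_ge0.
have Rn : R%:R ^+ n * R%:R^-1 ^+ n = 1 :> K by rewrite -exprMn divff ?expr1n // gt_eqF.
have Rn2 : R%:R ^+ n * (2 * R%:R^-1 ^+ n) = 2 :> K by rewrite mulrCA Rn mulr1.
(* After scaling by R^n the ball has radius 2 about a point of [0, 1], so it contains a
   neighbourhood of [0, 1]. *)
rewrite imass_full_itv ?mulr1 // mulrDr ?mulrN Rn2; move: k0 k1; rewrite /y; lra.
Qed.

End SelfSimilarMeasure.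

(** * The mass of balls around the endpoints 0 and 1 *)

Section EndpointMass.
Set Implicit Arguments.
Unset Strict Implicit.
Unset Printing Implicit Defensive.
Variables (K : realType) (m R : nat).
Hypotheses (hR : (2 <= R)%N) (hm : (R <= m)%N).
Variables (p : 'I_m.+1 -> K) (mu : probability (measurableTypeR K) K).
Hypotheses (p_gt0 : forall j, 0 < p j) (p_sum : \sum_(j < m.+1) p j = 1).
Hypothesis mu_ss : self_similar mu (@ifs K m R) p.
Local Notation F := (imass mu).

Let d : K := (R%:R - 1) / m%:R.
Let Rge : 2 <= R%:R :> K. Proof. by rewrite ler_nat. Qed.
Let mge : R%:R <= m%:R :> K. Proof. by rewrite ler_nat. Qed.

(* The maps of index 0 and m fix the points 0 and 1. *)
Variables (x : K) (k : 'I_m.+1).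
Hypothesis xk : (x = 0 /\ k = ord0) \/ (x = 1 /\ k = ord_max).

Let x_itv : 0 <= x <= 1.
Proof. by case: xk => -[-> _]; rewrite ?lexx ?ler01. Qed.

Let fixed y : R%:R * (x + y / R%:R) - k%:R * d = x + y.
Proof.
have h1 := Rge; have h2 := mge.
case: xk => -[-> ->] /=; first by field; lra.
by rewrite /d; field; rewrite !gt_eqF //; lra.
Qed.

Let fixedN y : R%:R * (x - y / R%:R) - k%:R * d = x - y.
Proof. by rewrite -mulNr fixed. Qed.

(** Dividing the radius by R costs at most a factor [p k], so start from a radius r R^n > 2, for
    which the ball has mass 1. *)
Lemma endpoint_mass_gt0 r : 0 < r -> 0 < F (x - r) (x + r).
Proof.
move=> r0; have h1 := Rge; have Rgt0 : 0 < R%:R :> K by lra.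
have stp s : p k * F (x - s) (x + s) <= F (x - s / R%:R) (x + s / R%:R).
  rewrite (imass_self_similar hR hm mu_ss (x - s / _)) (bigD1 k) //= -/d fixed fixedN.
  by rewrite lerDl sumr_ge0 // => j _; rewrite mulr_ge0 ?imass_ge0 ?ltW.
have stpn n s : p k ^+ n * F (x - s) (x + s) <= F (x - s / R%:R ^+ n) (x + s / R%:R ^+ n).
  elim: n => [|n IH]; first by rewrite !expr0 mul1r divr1.
  have := stp (s / R%:R ^+ n); rewrite exprS exprSr invfM !mulrA.
  by apply: le_trans; rewrite -mulrA ler_wpM2l // ltW.
have [n nP] : exists n, 2 / r < R%:R ^+ n.
  exists (Num.bound (2 / r)); have := upper_nthrootP (leqnn (Num.bound (2 / r))).
  by move/lt_le_trans; apply; rewrite lerXn2r ?nnegrE ?ler0n.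
have := stpn n (r * R%:R ^+ n); rewrite mulfK ?expf_neq0 ?gt_eqF //.
apply: lt_le_trans; rewrite ltr_pdivrMr // mulrC in nP.
have /andP[? ?] := x_itv.
by rewrite (imass_full_itv hR hm p_gt0 p_sum mu_ss) ?mulr1 ?exprn_gt0 //; lra.
Qed.

(** For j other than k, the preimage of the smaller ball under S_j is the ball of radius r shifted
    outwards by at least d > r, so it misses [0, 1]. *)
Lemma endpoint_mass_scaling r : 0 < r -> r < d ->
  F (x - r / R%:R) (x + r / R%:R) = p k * F (x - r) (x + r).
Proof.
move=> r0 rd; rewrite (imass_self_similar hR hm mu_ss (x - r / _)) (bigD1 k) //= -/d fixed fixedN.
rewrite [X in _ + X]big1 ?addr0 // => j jk.
rewrite (imass_eq0 hR hm p_gt0 p_sum mu_ss) ?mulr0 //.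
have h1 := Rge; have h2 := mge; have dgt0 : 0 < d by exact: lt_trans rd.
have E1 : R%:R * (x - r / R%:R) = x - r + k%:R * d by rewrite -(fixedN r) subrK.
have E2 : R%:R * (x + r / R%:R) = x + r + k%:R * d by rewrite -(fixed r) subrK.
rewrite E1 E2; case: xk => -[xE kE]; rewrite xE kE.
  left; have : d <= j%:R * d.
    by rewrite -[leLHS]mul1r ler_pM2r // ler1n lt0n; move: jk; rewrite kE.
  by rewrite mul0r; lra.
right; have : j%:R * d + d <= m%:R * d.
  rewrite -[X in _ + X]mul1r -mulrDl natr1 ler_pM2r // ler_nat.
  rewrite ltn_neqAle -ltnS ltn_ord andbT; move: jk; rewrite kE -val_eqE //.
by rewrite /=; lra.
Qed.

End EndpointMass.

(** * Local dimensions *)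

Section LocalDimensions.
Set Implicit Arguments.
Unset Strict Implicit.
Unset Printing Implicit Defensive.
Variables (K : realType) (mu : probability (measurableTypeR K) K).
Local Notation F := (imass mu).

Lemma dim_quotientE x r : 0 < r -> r < 1 -> 0 < F (x - r) (x + r) ->
  dim_quotient mu x r = (ln (F (x - r) (x + r)) / ln r)%:E.
Proof.
move=> r0 r1 F0; have lr : ln r < 0 by rewrite ln_lt0 // r0.
by rewrite /dim_quotient imassE lne_EFin // inver lt_eqF.
Qed.

Lemma supp_itv x : (forall a b, b < 0 \/ 1 < a -> F a b = 0) -> supp mu x -> 0 <= x <= 1.
Proof.
move=> F0 sx.
have out a b : a < x -> x < b -> b < 0 \/ 1 < a -> False.
  move=> ax xb ab; have := sx `]a, b[%classic (interval_open _ _).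
  rewrite /= in_itv /= ax xb => /(_ isT isT isT).
  have mu0 : mu `[a, b]%classic = 0%E by rewrite imassE F0.
  apply/negP; rewrite -leNgt -mu0.
  apply: le_measure; rewrite ?inE; try exact: measurable_itv.
  by apply: subset_itv; rewrite bnd_simp.
apply/andP; split; rewrite leNgt; apply/negP => h.
  by apply: (out (x - 1) (x / 2)); [lra|lra|left; lra].
by apply: (out ((1 + x) / 2) (x + 1)); [lra|lra|right; lra].
Qed.

Lemma mem_supp x : (forall r, 0 < r -> 0 < F (x - r) (x + r)) -> supp mu x.
Proof.
move=> F0 U oU Ux; have /nbhs_ballP[e e0 eU] := open_nbhs_nbhs (conj oU Ux).
have : (0 < mu `[(x - e / 2)%R, (x + e / 2)%R]%classic)%E.
  by rewrite imassE lte_fin F0 // divr_gt0.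
move/lt_le_trans; apply; apply: le_measure; rewrite ?inE.
- exact: measurable_itv.
- exact: measurable_realfun.open_measurable.
move=> y; rewrite /= in_itv /= => /andP[y1 y2]; apply: eU.
by rewrite /ball /= ltr_norml; move: e0 => /= e0; apply/andP; split; lra.
Qed.

(* Along the scaling [r -> r / R] the function [ln (F (x - r) (x + r)) - s * ln r],
   with [s] the claimed dimension, is invariant, hence bounded near 0. *)
Lemma scaling_local_dim (x a b c : K) : 0 < a -> a < 1 -> 1 < b -> 0 < c -> c < 1 ->
  (forall r, 0 < r -> 0 < F (x - r) (x + r)) ->
  (forall r, 0 < r -> r < c -> F (x - r / b) (x + r / b) = a * F (x - r) (x + r)) ->
  dim_quotient mu x r @[r --> 0^'+] --> (`|ln a| / ln b)%:E.
Proof.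
move=> a0 a1 b1 c0 c1 F0 Fs; set s := `|ln a| / ln b.
have b0 : 0 < b by lra.
have lnb : 0 < ln b by rewrite ln_gt0.
have lna : ln a < 0 by rewrite ln_lt0 // a0.
have s_ge0 : 0 <= s by rewrite divr_ge0 // ltW.
have sb : s * ln b = - ln a by rewrite /s ltr0_norm // divfK // gt_eqF.
pose g r := ln (F (x - r) (x + r)) - s * ln r.
have gs r : 0 < r -> r < c -> g (r / b) = g r.
  move=> r0 rc; rewrite /g Fs // !lnM ?posrE ?invr_gt0 ?F0 //.
  by rewrite lnV ?posrE // mulrBr sb; lra.
pose c' := c / 2; have c'0 : 0 < c' by rewrite /c'; lra.
(* Both terms are nonnegative; by monotonicity they bound [g] on the fundamental range from [c' / b]
   to [c']. *)
pose C := - ln (F (x - c' / b) (x + c' / b)) - s * ln (c' / b).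
have c'b0 : 0 < c' / b by rewrite divr_gt0.
have gC0 r : c' / b < r -> r <= c' -> `|g r| <= C.
  move=> r1 r2; have r0 : 0 < r by apply: lt_trans r1.
  have l1 : ln (F (x - c' / b) (x + c' / b)) <= ln (F (x - r) (x + r)).
    by rewrite ler_ln ?posrE ?F0 // imass_le //; lra.
  have l2 : ln (F (x - r) (x + r)) <= 0 by rewrite ln_le0 // imass_le1.
  have l3 : ln (c' / b) <= ln r by rewrite ler_ln ?posrE // ltW.
  have l4 : ln r <= 0 by rewrite ln_le0 //; move: r2; rewrite /c'; lra.
  have l5 := ler_wpM2l s_ge0 l3; have l6 := ler_wpM2l s_ge0 l4.
  by rewrite ler_norml /C /g mulr0 in l6 *; apply/andP; split; lra.
(* The invariance under division by b carries the bound to smaller radii. *)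
have gCn n r : c' / b ^+ n.+1 < r -> r <= c' -> `|g r| <= C.
  elim: n r => [|n IH] r r1 r2; first exact: gC0.
  have [|rb] := ltP (c' / b) r; first by move=> ?; exact: gC0.
  have r0 : 0 < r by apply: lt_trans r1; rewrite divr_gt0 ?exprn_gt0.
  have rb' : r * b <= c' by rewrite -ler_pdivlMr.
  rewrite -[r](mulfK (lt0r_neq0 b0)) gs; last by move: rb'; rewrite /c'; lra.
    by apply: IH => //; rewrite exprSr invfM mulrA ltr_pdivrMr in r1.
  by rewrite mulr_gt0.
have gC r : 0 < r -> r <= c' -> `|g r| <= C.
  move=> r0 rc; pose n := Num.bound (c' / r / (b - 1)).
  have b10 : 0 < b - 1 by lra.
  apply: (gCn n) => //; rewrite ltr_pdivrMr ?exprn_gt0 // mulrC -ltr_pdivrMr //.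
  have n_gt : c' / r < n%:R * (b - 1).
    by rewrite -ltr_pdivrMr // archi_boundP // !divr_ge0 // ltW.
  apply: (lt_le_trans n_gt); have := b1.
  (* Bernoulli's inequality, in the weak form n (b - 1) <= b^(n+1). *)
  elim: (n) => [|k IH] _; first by rewrite mul0r exprn_ge0 // ltW.
  have bk : 1 <= b ^+ k.+1 by rewrite exprn_ege1 // ltW.
  by rewrite (exprS b k.+1) -natr1 mulrDl; have := IH b1; nra.
apply/fine_cvgP; split.
  near=> r; have r0 : 0 < r by [].
  have r1 : r < 1 by near: r; exact: nbhs_right_lt.
  by rewrite dim_quotientE ?F0.
apply/cvgrPdist_lt => e e0; near=> r.
have r0 : 0 < r by [].
have r1 : r < 1 by near: r; exact: nbhs_right_lt.
have rc : r <= c' by near: r; exact: nbhs_right_le.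
have lnr : ln r < - ((C + 1) / e) by near: r; exact: (cvgrNy_lt (@lnNy K)).
rewrite /= dim_quotientE ?F0 //=.
have C0 : 0 <= C by apply: le_trans (gC _ r0 rc).
have lr0 : ln r < 0 by apply: (lt_trans lnr); rewrite oppr_lt0 divr_gt0 //; lra.
have -> : s - ln (F (x - r) (x + r)) / ln r = - g r / ln r.
  by rewrite /g; field; rewrite lt_eqF.
rewrite normrM normrN normfV (ltr0_norm lr0) ltr_pdivrMr ?oppr_gt0 //.
apply: (le_lt_trans (gC _ r0 rc)).
have : (C + 1) / e < - ln r by lra.
by rewrite ltr_pdivrMr //; lra.
Unshelve. all: by end_near.
Qed.

(** Since the limit exists, the radii 2 b^-n suffice. If it exceeded a real t > s, then the quotient
    would be above t at all small radii, against the lower bound on the mass. *)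
Lemma local_dim_le (x q b c : K) (N : nat) : 0 < q -> q < 1 -> 1 < b -> 0 < c ->
  (forall n, (N <= n)%N -> c * q ^+ n <= F (x - 2 * b^-1 ^+ n) (x + 2 * b^-1 ^+ n)) ->
  has_local_dim mu x -> (local_dim mu x <= (`|ln q| / ln b)%:E)%E.
Proof.
move=> q0 q1 b1 c0 FP hx; set s := `|ln q| / ln b.
have b0 : 0 < b by lra.
have lnb : 0 < ln b by rewrite ln_gt0.
have lnq : ln q < 0 by rewrite ln_lt0 // q0.
have cv : dim_quotient mu x r @[r --> 0^'+] --> local_dim mu x := hx.
rewrite leNgt; apply/negP => sl.
have [t st tl] : exists2 t, s < t & (t%:E < local_dim mu x)%E.
  move: sl; case: (local_dim mu x) => [l| |] // sl; last by exists (s + 1); rewrite ?ltry //; lra.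
  by rewrite lte_fin in sl; exists ((s + l) / 2); rewrite ?lte_fin; lra.
have nb : nbhs (local_dim mu x) [set y | (t%:E < y)%E].
  by apply: open_nbhs_nbhs; split=> //; exact: open_ereal_gt_ereal.
have [e /= e0 eP] := cv _ nb.
(* With r = 2 b^-n one has ln (c q^n) - t ln r = ln c - t ln 2 + n A, which is positive for large n
   because A > 0. *)
pose A := t * ln b + ln q.
have A0 : 0 < A.
  by move: st; rewrite /s ltr0_norm // ltr_pdivrMr // /A; lra.
have e10 : 0 < Num.min e 1 / 2 by rewrite divr_gt0 // lt_min e0 ltr01.
have binv : `|b^-1| < 1 by rewrite ger0_norm ?invr_ge0 ?ltW // invf_lt1.
have [n [Nn rn An]] : exists n, [/\ (N <= n)%N, b^-1 ^+ n < Num.min e 1 / 2 &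
    (t * ln 2 - ln c) / A < n%:R].
  near \oo => n; exists n; split; near: n.
  - exact: nbhs_infty_ge.
  - by apply: cvgr_lt e10; exact: cvg_expr.
  - exact: nbhs_infty_gtr.
pose r := 2 * b^-1 ^+ n; have r0 : 0 < r by rewrite mulr_gt0 // exprn_gt0 // invr_gt0.
have : r < Num.min e 1 by rewrite /r; lra.
rewrite lt_min => /andP[re r1].
have Fr := FP n Nn; rewrite -/r in Fr.
have cq0 : 0 < c * q ^+ n by rewrite mulr_gt0 // exprn_gt0.
have Fr0 : 0 < F (x - r) (x + r) by apply: lt_le_trans Fr.
have lr : ln r < 0 by rewrite ln_lt0 // r0.
have /= := eP r; rewrite sub0r normrN gtr0_norm // => /(_ re r0).
rewrite dim_quotientE // lte_fin ltr_ndivlMr //; apply/negP; rewrite -leNgt.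
have : ln (c * q ^+ n) <= ln (F (x - r) (x + r)) by rewrite ler_ln ?posrE.
apply: le_trans; rewrite !lnM ?posrE ?exprn_gt0 ?invr_gt0 // !lnXn ?invr_gt0 //.
rewrite lnV ?posrE // -(mulr_natr (- ln b)) -(mulr_natr (ln q)).
by move: An; rewrite ltr_pdivrMr // /A; lra.
Unshelve. all: by end_near.
Qed.

End LocalDimensions.

Theorem proposition7p1 (K : realType) (m R : nat) (hR : (2 <= R)%N)
    (hm : (R <= m)%N) (p : 'I_m.+1 -> K)
    (p_gt0 : forall j, 0 < p j)
    (p_sum : \sum_(j < m.+1) p j = 1)
    (p_ends : p ord0 = p ord_max)
    (p_min : forall j : 'I_m.+1, j != ord0 -> j != ord_max -> p ord0 < p j)
    (mu : probability (measurableTypeR K) K)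
    (mu_ss : self_similar mu (@ifs K m R) p) :
  let q := \big[Num.min/2 * p ord0]_(j < m.+1 | (j != ord0) && (j != ord_max))
             p j in
  [/\ essential_points (@ifs K m R) R%:R^-1 = `]0, 1[%classic,
      has_local_dim mu 0 /\ isolated (local_dims mu) (local_dim mu 0),
      forall x, `]0, 1[%classic x -> has_local_dim mu x ->
        (local_dim mu x <= (`|ln q| / ln R%:R)%:E)%E,
      `|ln q| / ln R%:R < `|ln (p ord0)| / ln R%:R :> K &
      (`|ln (p ord0)| / ln R%:R)%:E = local_dim mu 0].
Proof.
move=> q; set a := p ord0; set s := `|ln a| / _; set t := `|ln q| / _.
have a0 : 0 < a by exact: p_gt0.
have R2 : 2 <= R%:R :> K by rewrite ler_nat.
have Rm : R%:R <= m%:R :> K by rewrite ler_nat.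
have R1 : 1 < R%:R :> K by lra.
have lnR : 0 < ln R%:R :> K by rewrite ln_gt0.
have aq : a < q by apply: lt_bigmin => [|j /andP[? ?]]; [rewrite -/a; lra|exact: p_min].
have q0 : 0 < q by exact: lt_trans aq.
have q2 : q <= p ord0 + p ord_max.
  by rewrite -p_ends -/a (_ : a + a = 2 * a) ?bigmin_le_id //; ring.
have qp j : j != ord0 -> j != ord_max -> q <= p j.
  by move=> j0 jm; apply: bigmin_le_cond; rewrite j0.
have q1 : q < 1.
  (* As m >= 2, the digit 1 is interior; together with p_0 > 0 this leaves its probability, and so
     [q], below 1. *)
  have j1m : (1 < m.+1)%N by lia.
  have j1 : Ordinal j1m != ord0 by [].
  have : q <= p (Ordinal j1m) by apply: qp => //; rewrite -val_eqE /=; lia.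
  move/le_lt_trans; apply; rewrite -p_sum (bigD1 ord0) //= (bigD1 (Ordinal j1m)) //=.
  rewrite addrCA ltrDl (lt_le_trans a0) // lerDl sumr_ge0 // => j _.
  exact/ltW.
have a1 : a < 1 by exact: lt_trans q1.
have ts : t < s.
  by rewrite ltr_pM2r ?invr_gt0 // !ltr0_norm ?ln_lt0 ?q0 ?a0 // ltrN2 ltr_ln.
have d0 : 0 < (R%:R - 1) / m%:R :> K by rewrite divr_gt0 //; lra.
have d1 : (R%:R - 1) / m%:R < 1 :> K by rewrite ltr_pdivrMr; lra.
(* The endpoint 1 is treated along with 0: it also belongs to the support, and isolation requires
   its dimension to be the same. *)
have ends x (k : 'I_m.+1) : (x = 0 /\ k = ord0) \/ (x = 1 /\ k = ord_max) ->
    supp mu x /\ (dim_quotient mu x r @[r --> 0^'+] --> s%:E).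
  move=> xk; have F0 := endpoint_mass_gt0 hR hm p_gt0 p_sum mu_ss xk.
  split; first exact: mem_supp.
  apply: (scaling_local_dim a0 a1 R1 d0 d1 F0) => r r0 rd.
  rewrite (endpoint_mass_scaling hR hm p_gt0 p_sum mu_ss xk) //.
  by case: xk => -[_ ->]; rewrite // -p_ends.
have dimE x : dim_quotient mu x r @[r --> 0^'+] --> s%:E -> local_dim mu x = s%:E.
  by move=> cv; apply: cvg_lim => //; exact: ereal_hausdorff.
have [s0 cv0] := ends 0 ord0 (or_introl (conj erefl erefl)).
have [_ cv1] := ends 1 ord_max (or_intror (conj erefl erefl)).
have h0 : has_local_dim mu 0 by apply/cvg_ex; exists s%:E.
have inner x : 0 < x -> x < 1 -> has_local_dim mu x -> (local_dim mu x <= t%:E)%E.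
  move=> x0 x1; have [c c0 [N cN]] :=
    imass_inner_lower hR hm p_gt0 p_sum mu_ss q0 q2 qp x0 x1.
  exact: local_dim_le q0 q1 R1 c0 cN.
split=> //.
- exact: essential_pointsE.
- split=> //; split; first by apply/mem_set; exists 0.
  (* Dimensions at points of (0, 1) are at most t, so above t only the common value s of the two
     endpoints remains. *)
  exists [set y | (t%:E < y)%E].
    apply: open_nbhs_nbhs; split; first exact: open_ereal_gt_ereal.
    by rewrite /= dimE // lte_fin.
  apply/seteqP; split=> y /=; last first.
    by move=> ->; split; [rewrite dimE // lte_fin|exists 0].
  move=> [ty [x [sx hx] xy]]; rewrite -xy (dimE 0) //.
  have /andP[] := supp_itv (imass_eq0 hR hm p_gt0 p_sum mu_ss) sx.
  rewrite le_eqVlt => /predU1P[<- _|x0]; first exact: dimE.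
  rewrite le_eqVlt => /predU1P[->|x1]; first exact: dimE.
  by move: ty; rewrite -xy ltNge inner.
- by move=> x /=; rewrite in_itv /= => /andP[x0 x1]; exact: inner.
- by rewrite dimE.
Qed.
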